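(* There exists an absolute constant $C>0$ such that the following holds. Let $X=(X_1,\ldots,X_n)$ be a random vector in $\mathbb{R}^n$ with independent real-valued coordinates. Assume that the densities of $X_1,\ldots,X_n$ are bounded by $K$. Let $A$ be a non-zero $m\times n$ real matrix. Then for any $\tau>0$, $$\mathcal{L}(AX,\,\tau\|A\|)\le (CK\tau)^{r(A)}.$$
   Context: For a random vector $Z$ taking values in $\mathbb{R}^k$, the concentration function is $\mathcal{L}(Z,t)=\max_{u\in\mathbb{R}^k}\mathbb{P}\{\|Z-u\|_2\le t\}$ for $t\ge 0$, where $\|\cdot\|_2$ is the Euclidean norm. $\|A\|_{\mathrm{HS}}$ denotes the Hilbert-Schmidt (Frobenius) norm and $\|A\|$ the operator (spectral) norm of $A$. The stable rank of $A$ is defined as $r(A)=\left\lfloor \|A\|_{\mathrm{HS}}^2/\|A\|^2\right\rfloor$. *)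

(* Defs.v *)
From HB Require Import structures.
From mathcomp Require Import all_boot all_order all_algebra.
From mathcomp Require Import all_classical all_reals all_analysis.

Set Implicit Arguments.
Unset Strict Implicit.
Unset Printing Implicit Defensive.

Import Order.TTheory GRing.Theory Num.Theory.
Import numFieldNormedType.Exports.

Local Open Scope classical_set_scope.
Local Open Scope ring_scope.

Section matrix_norms.
Context {R : realType}.

(* The norm that MathComp-Analysis puts on matrices is the max norm, so the
   Euclidean, Hilbert-Schmidt and spectral norms are defined explicitly. *)
Definition norm2 k (v : 'cV[R]_k) : R :=
  Num.sqrt (\sum_(i < k) v i ord0 ^+ 2).

Definition hs_norm m n (A : 'M[R]_(m, n)) : R :=
  Num.sqrt (\sum_(i < m) \sum_(j < n) A i j ^+ 2).

Definition op_norm m n (A : 'M[R]_(m, n)) : R :=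
  sup [set norm2 (A *m x) | x in [set x : 'cV[R]_n | norm2 x <= 1]].

Definition stable_rank m n (A : 'M[R]_(m, n)) : nat :=
  Num.truncn (hs_norm A ^+ 2 / op_norm A ^+ 2).

End matrix_norms.

Section random_vectors.
Context {d : measure_display} {T : measurableType d} {R : realType}.
Variable P : probability T R.

(* The supremum is attained whenever Z is measurable, so it is a maximum. *)
Definition concentration k (Z : T -> 'cV[R]_k) (t : R) : \bar R :=
  ereal_sup [set P [set w | norm2 (Z w - u) <= t] | u in [set: 'cV[R]_k]].

Definition rv_col n (X : 'I_n -> {RV P >-> R}) (w : T) : 'cV[R]_n :=
  \col_i X i w.

Definition mutually_independent n (X : 'I_n -> {RV P >-> R}) : Prop :=
  forall (J : {set 'I_n}) (B : 'I_n -> set R),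
    (forall i, measurable (B i)) ->
    P (\bigcap_(i in [set` J]) X i @^-1` B i) =
    (\prod_(i in J) P (X i @^-1` B i))%E.

Definition has_density (X : {RV P >-> R}) (f : R -> R) : Prop :=
  [/\ measurable_fun [set: R] f,
      forall x, 0 <= f x &
      forall B : set R, measurable B ->
        distribution P X B = (\int[lebesgue_measure]_(x in B) (f x)%:E)%E].

End random_vectors.

(* Main.v *)
(* Scale so that the columns [a j] of [A / |A|] satisfy
   [\sum_j <a j, y>^2 <= |y|^2], and put [p j = |a j|^2], so that
   [\sum_j p j >= r(A) = k].  The small ball probability of [Z = A X / |A| - u]
   is at most twice the mean of the Gaussian kernel [E_g cos(r <Z, g>)], with [r]
   proportional to [1 / tau], and the mean of the kernel is bounded by
   [(C K / r)^k] as follows.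

   If [p j > 1/2] for some [j], integrate [X j] out first: its density is bounded
   and the kernel is integrable along [a j], which costs a factor [C K / r].  What
   is left is the kernel of the projections of the columns orthogonally to [a j];
   this projection lowers [\sum_j p j] by at most [1], so that one inducts on [k].

   Otherwise exchange the integrals and bound the mean by
   [E_g \prod_j rho_j(r <a j, g>)], where [rho_j] is the modulus of the
   characteristic function of [X j].  Write [rho_j] as [F j `^ p j].  A rank-one
   Brascamp-Lieb inequality for the Gaussian measure, proved by induction on the
   number of columns with Hoelder's inequality, reduces to bounding one-dimensional
   integrals of the [F j] by [C K sqrt (p j) / r].  That estimate combines
   the L^2 bound for [rho_j] (bounded density of [X j - X j']) with the doubling
   inequality [1 - rho(2t)^2 <= 4 (1 - rho(t)^2)]. *)
Require Import Defs.
From HB Require Import structures.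
From mathcomp Require Import all_boot all_order all_algebra.
From mathcomp Require Import all_classical all_reals all_analysis.
From mathcomp Require Import measurable_realfun.
From mathcomp Require Import ring lra.

Set Implicit Arguments.
Unset Strict Implicit.
Unset Printing Implicit Defensive.

Import Order.TTheory GRing.Theory Num.Theory.
Import numFieldNormedType.Exports.

Local Open Scope classical_set_scope.
Local Open Scope ring_scope.

(** The threshold [1/2] is dictated by the exponents: [F j] is the squared modulus raised to
    [1 / (2 p j)], and the one-dimensional estimate gains its factor [sqrt (p j)] only when this
    exponent is at least [1]. A longer column fails this, but it occupies a fixed share of its own
    direction, so integrating its coordinate alone loses only a constant.

    The constant must depend neither on [n] nor on the dimensions. Each column costs
    [expR (p j / 2)] up to an arbitrarily small excess, so the loss is exponential in [\sum_j p j]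
    and not in [n]. When that sum exceeds [k], the surplus only helps, unless the claimed bound is
    already at least [1].

    The frame condition is an inequality and not a decomposition of the identity. The Gaussian
    weight tolerates this, and it is invariant under the rotations that align a column with the
    first axis. *)

(** * Integration against image measures and densities, affine substitutions *)

Section image_measure.
Context d1 d2 (T1 : measurableType d1) (T2 : measurableType d2) (R : realType).
Variables (m : {measure set T1 -> \bar R}) (f : T1 -> T2).
Hypothesis mf : measurable_fun setT f.
Local Open Scope ereal_scope.

(* The measure structure on [pushforward m f] takes [mf] as an argument that
   unification cannot recover; this packs it. *)
Definition image_measure : {measure set T2 -> \bar R} :=
  measure_function_pushforward__canonical__measure_function_Measure m mf.

Lemma integral_image_measure (h : T2 -> \bar R) :
  measurable_fun setT h -> (forall x, 0 <= h x) ->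
  \int[image_measure]_x h x = \int[m]_x h (f x).
Proof. by move=> mh h0; rewrite ge0_integral_pushforward. Qed.

End image_measure.

Section integral_against_density.
Context {R : realType}.
Local Notation mu := (@lebesgue_measure R).
Local Open Scope ereal_scope.

Import HBNNSimple.

(** The hypothesis on [m] speaks of sets, so the identity is checked on the level sets of simple
    functions and passed to [h] by monotone convergence on both sides. *)
Lemma integral_density (m : {measure set R -> \bar R}) (f : R -> R)
    (h : R -> \bar R) :
  measurable_fun [set: R] f -> (forall x, 0 <= f x)%R ->
  (forall A, measurable A -> m A = \int[mu]_(x in A) (f x)%:E) ->
  measurable_fun [set: R] h -> (forall x, 0 <= h x) ->
  \int[m]_x h x = \int[mu]_x (h x * (f x)%:E).
Proof.
move=> mf f0 mE mh h0; pose h_ := nnsfun_approx measurableT mh.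
have mfE : measurable_fun [set: R] (EFin \o f) by exact/measurable_EFinP.
have hE x : h x = lim ((EFin \o h_ n) x @[n --> \oo]).
  by apply/esym/cvg_lim => //; exact: cvg_nnsfun_approx.
have mmul g : measurable_fun [set: R] g ->
    measurable_fun [set: R] (fun x => g x * (f x)%:E).
  by move=> mg; exact: emeasurable_funM.
have -> : \int[m]_x h x = lim (\int[m]_x (h_ n x)%:E @[n --> \oo]).
  under eq_integral do rewrite hE.
  apply: monotone_convergence => //.
  - by move=> n; exact/measurable_EFinP/measurable_funP.
  - by move=> n x _; rewrite lee_fin.
  - by move=> x _ a b ab; rewrite lee_fin; exact/lefP/nd_nnsfun_approx.
have -> : \int[mu]_x (h x * (f x)%:E) =
    lim (\int[mu]_x ((h_ n x)%:E * (f x)%:E) @[n --> \oo]).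
  have fg x : h x * (f x)%:E = lim (((EFin \o h_ n) x * (f x)%:E) @[n --> \oo]).
    apply/esym/cvg_lim => //; apply: cvgeZr => //.
    by apply: cvg_nnsfun_approx.
  under eq_integral do rewrite fg.
  apply: monotone_convergence => //.
  - by move=> n; apply: mmul; exact/measurable_EFinP/measurable_funP.
  - by move=> n x _; rewrite mule_ge0 ?lee_fin.
  - move=> x _ a b ab; apply: lee_wpmul2r; rewrite ?lee_fin//.
    by have /lefP/(_ x) := nd_nnsfun_approx measurableT mh ab.
congr (limn _); apply/funext => n.
transitivity (\int[m]_x
   (\sum_(y \in range (h_ n)) (y * \1_(h_ n @^-1` [set y]) x)%:E)).
  by apply: eq_integral => t tE; rewrite /= fimfunE -fsumEFin.
have indich r : measurable_fun [set: R] (fun x => (r * \1_(h_ n @^-1` [set r]) x)%:E).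
  by apply/measurable_EFinP; exact: measurable_funM.
rewrite ge0_integral_fsum//; last by move=> y x _; exact: nnfun_muleindic_ge0.
transitivity (\int[mu]_x (\sum_(y \in range (h_ n))
    (y * \1_(h_ n @^-1` [set y]) x)%:E * (f x)%:E)); last first.
  apply: eq_integral => x _.
  rewrite -ge0_mule_fsuml => [|y]; last exact: nnfun_muleindic_ge0.
  rewrite fsumEFin//; congr (_%:E * _).
  exact/esym/fimfunE.
rewrite ge0_integral_fsum//; last 2 first.
  - by move=> y; exact: mmul.
  - by move=> y x _; rewrite mule_ge0 ?lee_fin// -lee_fin nnfun_muleindic_ge0.
apply: eq_fsbigr => r rhn.
transitivity (r%:E * m (h_ n @^-1` [set r])).
  by rewrite integralZl_indic_nnsfun//; congr (_ * _); rewrite integral_indic ?setIT.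
rewrite mE//.
under [RHS]eq_integral do rewrite EFinM -muleA.
rewrite ge0_integralZl//.
- congr (_ * _); rewrite [LHS]integral_mkcond; apply: eq_integral => x _.
  by rewrite epatch_indic /= muleC.
- by apply: mmul; exact/measurable_EFinP.
- by move=> t _; rewrite mule_ge0 ?lee_fin.
- by move: rhn; rewrite inE => -[t _ <-]; rewrite lee_fin.
Qed.

End integral_against_density.

Section affine_change_of_variables.
Context {R : realType}.
Local Notation mu := (@lebesgue_measure R).
Local Open Scope ereal_scope.

Let affine_measurable (a b : R) :
  measurable_fun [set: measurableTypeR R]
    (fun x : measurableTypeR R => (a * x + b)%R : measurableTypeR R).
Proof. by apply: measurable_funD => //; exact: measurable_funM. Qed.

Lemma integral_lebesgue_opp (h : R -> \bar R) :
  measurable_fun [set: R] h -> (forall x, 0 <= h x) ->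
  \int[mu]_x h (- x)%R = \int[mu]_x h x.
Proof.
move=> mh h0.
transitivity (\int[pushforward mu (-%R : _ -> measurableTypeR R)]_x h x).
  by rewrite ge0_integral_pushforward.
by apply: eq_measure_integral => A mA _; exact: lebesgue_measureN.
Qed.

Lemma integral_lebesgue_affine_gt0 (a b : R) (h : R -> \bar R) : (0 < a)%R ->
  measurable_fun [set: R] h -> (forall x, 0 <= h x) ->
  \int[mu]_x h (a * x + b)%R = (a^-1)%:E * \int[mu]_x h x.
Proof.
move=> a0 mh h0.
pose phi : measurableTypeR R -> measurableTypeR R := fun x => (a * x + b)%R.
pose phi' : measurableTypeR R -> measurableTypeR R := fun x => (a^-1 * x - a^-1 * b)%R.
have mphi : measurable_fun setT phi by exact: affine_measurable.
have mphi' : measurable_fun setT phi' by exact: affine_measurable.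
pose k := NngNum (ltW a0).
pose nu : {measure set (measurableTypeR R) -> \bar R} :=
  mscale k (image_measure mu mphi).
have E : forall A, measurable A -> mu A = nu A.
  apply: lebesgue_measure_unique => //= _ [[x y]] _ <-.
  rewrite [RHS](_ : _ = a%:E * mu (phi @^-1` `]x, y]))//.
  have -> : phi @^-1` `]x, y] = `]phi' x, phi' y]%classic.
    apply/seteqP; split => z /=; rewrite !in_itv/= /phi /phi' => /andP[h1 h2].
      by apply/andP; split; rewrite -mulrBr ?ltr_pdivrMl ?ler_pdivlMl//; lra.
    move: h1 h2; rewrite -!mulrBr ltr_pdivrMl// ler_pdivlMl// => h1 h2.
    by apply/andP; split; lra.
  rewrite !lebesgue_measure_itv /= !lte_fin.
  rewrite /phi' ltrD2r ltr_pM2l ?invr_gt0//.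
  case: ifPn => // _; last by rewrite mule0.
  by rewrite -!EFinB -EFinM; congr EFin; rewrite opprB; field; rewrite gt_eqF.
rewrite [X in _ = _ * X](@eq_measure_integral _ _ _ setT nu); last by move=> A mA _; exact: E.
rewrite ge0_integral_mscale// muleA -EFinM /= mulVf ?gt_eqF// mul1e.
by rewrite integral_image_measure.
Qed.

Lemma integral_lebesgue_affine (a b : R) (h : R -> \bar R) : (a != 0)%R ->
  measurable_fun [set: R] h -> (forall x, 0 <= h x) ->
  \int[mu]_x h (a * x + b)%R = (`|a|^-1)%:E * \int[mu]_x h x.
Proof.
move=> a0 mh h0; have [ap|an|aE] := ltgtP a 0%R; last by rewrite aE eqxx in a0.
- have := @integral_lebesgue_affine_gt0 (- a) b h.
  rewrite oppr_gt0 ltr0_norm// => /(_ ap mh h0) <-.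
  rewrite -[RHS]integral_lebesgue_opp//.
  + by apply: eq_integral => x _; rewrite mulrNN.
  + by apply: measurableT_comp => //; exact: affine_measurable.
- by rewrite integral_lebesgue_affine_gt0// gtr0_norm.
Qed.

End affine_change_of_variables.

(** * Gaussian measures and their rotations *)

Section gaussian_line.
Context {R : realType}.
Local Notation mu := (@lebesgue_measure R).
Local Open Scope ereal_scope.

(* [normal_prob] lives on [measurableTypeR R]; products of laws are taken over
   [R] with its default measurable structure. *)
Definition gauss : set R -> \bar R := normal_prob (0 : R) 1.

Let gauss0 : gauss set0 = 0. Proof. exact: measure0. Qed.
Let gauss_ge0 A : 0 <= gauss A. Proof. exact: measure_ge0. Qed.
Let gauss_semi_sigma_additive : semi_sigma_additive gauss.
Proof. exact: (@measure_semi_sigma_additive _ _ _ (normal_prob (0 : R) 1)). Qed.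
HB.instance Definition _ := isMeasure.Build _ _ _ gauss gauss0 gauss_ge0
  gauss_semi_sigma_additive.

Let gauss_setT : gauss setT = 1. Proof. exact: probability_setT. Qed.
HB.instance Definition _ := @Measure_isProbability.Build _ _ R gauss gauss_setT.

Definition gauss_pdf (x : R) : R := normal_pdf (0 : R) 1 x.

Lemma gauss_pdfE x : gauss_pdf x = (normal_peak 1 * expR (- x ^+ 2 / 2))%R.
Proof.
by rewrite /gauss_pdf normal_pdfE ?oner_eq0// /normal_fun subr0 expr1n.
Qed.

Lemma gauss_pdf_ge0 x : (0 <= gauss_pdf x)%R.
Proof. exact: normal_pdf_ge0. Qed.

Lemma measurable_gauss_pdf : measurable_fun [set: R] gauss_pdf.
Proof. exact: measurable_normal_pdf. Qed.

Lemma integral_gauss (h : R -> \bar R) :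
  measurable_fun [set: R] h -> (forall x, 0 <= h x) ->
  \int[gauss]_x h x = \int[mu]_x (h x * (gauss_pdf x)%:E).
Proof.
move=> mh h0; apply: (@integral_density R gauss) => //.
- exact: measurable_gauss_pdf.
- exact: gauss_pdf_ge0.
Qed.

Lemma gauss_pdf_rotation (c s x y : R) : (c ^+ 2 + s ^+ 2 = 1)%R ->
  (gauss_pdf (c * x - s * y) * gauss_pdf (s * x + c * y) =
   gauss_pdf x * gauss_pdf y)%R.
Proof.
move=> cs; rewrite !gauss_pdfE mulrACA [RHS]mulrACA -!expRD.
congr (_ * expR _)%R.
transitivity (- ((c ^+ 2 + s ^+ 2) * (x ^+ 2 + y ^+ 2)) / 2)%R; first by field.
by rewrite cs; field.
Qed.

(** Two affine substitutions with a Tonelli exchange between them: [u = c x - s y] at fixed [x],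
    then [w = (x - c u) / s] at fixed [u]. Their Jacobian factors [1 / |s|] and [|s|] cancel. *)
Lemma integral2_lebesgue_rotation (c s : R) (h : R * R -> \bar R) :
  (s != 0)%R -> (c ^+ 2 + s ^+ 2 = 1)%R ->
  measurable_fun setT h -> (forall x, 0 <= h x) ->
  \int[mu]_x \int[mu]_y h (c * x - s * y, s * x + c * y)%R =
  \int[mu]_x \int[mu]_y h (x, y).
Proof.
move=> s0 cs mh h0.
pose k (z : R * R) := h (z.2, s^-1 * z.1 + - (s^-1 * c * z.2))%R.
have mk : measurable_fun setT k.
  apply: measurableT_comp => //; apply: measurable_fun_pair => //.
  apply: measurable_funD; first exact: measurable_funM.
  by apply: measurableT_comp => //; exact: measurable_funM.
have k0 z : 0 <= k z by exact: h0.
transitivity (\int[mu]_x ((`|s|^-1)%:E * \int[mu]_u k (x, u))).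
  apply: eq_integral => x _.
  have mkx : measurable_fun [set: R] (fun u => k (x, u)).
    by apply: (measurableT_comp mk); exact: measurable_pair1.
  rewrite -normrN -(@integral_lebesgue_affine _ (- s) (c * x)%R) ?oppr_eq0//.
  apply: eq_integral => y _; rewrite /k/=; congr (h (_, _)); first by rewrite addrC mulNr.
  transitivity ((s^-1 * (x * (1 - c ^+ 2)) + c * y * (s / s)))%R; last by field.
  by rewrite -cs; field.
rewrite ge0_integralZl//; last 2 first.
- exact: (measurable_fun_fubini_tonelli_F (m2 := mu) k mk k0).
- by move=> x _; apply: integral_ge0 => y _; exact: h0.
rewrite (fubini_tonelli (m1 := mu) (m2 := mu) k mk k0).
transitivity ((`|s|^-1)%:E * \int[mu]_u (`|s|%:E * \int[mu]_w h (u, w))).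
  congr (_ * _); apply: eq_integral => u _.
  rewrite /k/= (@integral_lebesgue_affine _ s^-1 _ (fun w => h (u, w)))//.
  - by rewrite normfV invrK.
  - by rewrite invr_eq0.
  - exact: measurableT_comp.
rewrite ge0_integralZl//; last 2 first.
- exact: (measurable_fun_fubini_tonelli_F (m2 := mu) h mh h0).
- by move=> x _; apply: integral_ge0 => y _; exact: h0.
by rewrite muleA -EFinM mulVf ?mul1e// normr_eq0.
Qed.

Lemma integral2_gauss (h : R * R -> \bar R) :
  measurable_fun setT h -> (forall x, 0 <= h x) ->
  \int[gauss]_x \int[gauss]_y h (x, y) =
  \int[mu]_x \int[mu]_y (h (x, y) * (gauss_pdf x * gauss_pdf y)%:E).
Proof.
move=> mh h0; rewrite integral_gauss//; last 2 first.
- exact: (measurable_fun_fubini_tonelli_F (m2 := gauss) h mh h0).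
- by move=> x; apply: integral_ge0 => y _; exact: h0.
apply: eq_integral => x _.
have mhx : measurable_fun [set: R] (fun y => h (x, y)) by exact: measurableT_comp.
have mhg : measurable_fun [set: R] (fun y => h (x, y) * (gauss_pdf y)%:E).
  by apply: emeasurable_funM => //; apply/measurable_EFinP; exact: measurable_gauss_pdf.
rewrite integral_gauss// muleC -ge0_integralZl ?lee_fin ?gauss_pdf_ge0//; last first.
  by move=> y _; rewrite mule_ge0// lee_fin gauss_pdf_ge0.
by apply: eq_integral => y _; rewrite EFinM muleCA.
Qed.

Lemma integral2_gauss_rotation (c s : R) (h : R * R -> \bar R) :
  (s != 0)%R -> (c ^+ 2 + s ^+ 2 = 1)%R ->
  measurable_fun setT h -> (forall x, 0 <= h x) ->
  \int[gauss]_x \int[gauss]_y h (c * x - s * y, s * x + c * y)%R =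
  \int[gauss]_x \int[gauss]_y h (x, y).
Proof.
move=> s0 cs mh h0.
pose H (z : R * R) := h z * (gauss_pdf z.1 * gauss_pdf z.2)%:E.
have mH : measurable_fun setT H.
  apply: emeasurable_funM => //; apply/measurable_EFinP.
  by apply: measurable_funM; apply: measurableT_comp => //; exact: measurable_gauss_pdf.
have H0 z : 0 <= H z by rewrite mule_ge0// lee_fin mulr_ge0 ?gauss_pdf_ge0.
transitivity (\int[mu]_x \int[mu]_y H (c * x - s * y, s * x + c * y)%R).
  pose k (z : R * R) := h (c * z.1 - s * z.2, s * z.1 + c * z.2)%R.
  have mk : measurable_fun setT k.
    apply: measurableT_comp => //; apply: measurable_fun_pair.
      apply: measurable_funD; first exact: measurable_funM.
      by apply: measurableT_comp => //; exact: measurable_funM.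
    by apply: measurable_funD => //; exact: measurable_funM.
  have k0 z : 0 <= k z by exact: h0.
  rewrite (integral2_gauss mk k0).
  apply: eq_integral => x _; apply: eq_integral => y _.
  by rewrite /H/= gauss_pdf_rotation.
by rewrite (integral2_lebesgue_rotation s0 cs mH H0) (integral2_gauss mh h0).
Qed.

(* [N(0, 1)] is dominated by [c] times [N(0, c^2)]: the densities compare at
   every point. *)
Lemma integral_gauss_dilate (c : R) (h : R -> \bar R) : (1 <= c)%R ->
  measurable_fun [set: R] h -> (forall x, 0 <= h x) ->
  \int[gauss]_x h x <= c%:E * \int[gauss]_x h (c * x)%R.
Proof.
move=> c1 mh h0; have c0 : (0 < c)%R by exact: lt_le_trans c1.
have mhc : measurable_fun [set: R] (fun x => h (c * x)%R).
  by apply: measurableT_comp => //; exact: measurable_funM.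
have mg : measurable_fun [set: R] (EFin \o gauss_pdf).
  by apply/measurable_EFinP; exact: measurable_gauss_pdf.
rewrite !integral_gauss//.
pose k x := h x * (gauss_pdf (c^-1 * x))%:E.
have mk : measurable_fun [set: R] k.
  apply: emeasurable_funM => //; apply/measurable_EFinP.
  by apply: measurableT_comp; [exact: measurable_gauss_pdf|exact: measurable_funM].
have k0 x : 0 <= k x by rewrite mule_ge0// lee_fin gauss_pdf_ge0.
have -> : \int[mu]_x (h (c * x)%R * (gauss_pdf x)%:E) = (c^-1)%:E * \int[mu]_x k x.
  have := @integral_lebesgue_affine _ c 0%R k (lt0r_neq0 c0) mk k0.
  rewrite (gtr0_norm c0) => <-.
  by apply: eq_integral => x _; rewrite /k addr0 mulKf// gt_eqF.
rewrite muleA -EFinM mulfV ?gt_eqF// mul1e; apply: ge0_le_integral => //.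
- by move=> x _; rewrite mule_ge0// lee_fin gauss_pdf_ge0.
- exact: emeasurable_funM.
- move=> x _; apply: lee_wpmul2l => //; rewrite lee_fin !gauss_pdfE.
  rewrite ler_wpM2l ?normal_peak_ge0// ler_expR !mulNr lerN2 ler_pM2r ?invr_gt0//.
  rewrite exprMn ler_piMl ?sqr_ge0// expr_le1 ?invr_ge0 ?invf_le1 //; exact: ltW.
Qed.

End gaussian_line.

Section iterated_products.
Context {R : realType}.
Local Open Scope ereal_scope.

(* [R^m] as an iterated product, since product measures and Tonelli's theorem are
   available for binary products. *)
Fixpoint vec_space (m : nat) : {d : measure_display & measurableType d} :=
  match m with
  | 0 => existT (fun d => measurableType d) _ (unit : measurableType _)
  | m'.+1 => existT (fun d => measurableType d) _
      ((R * projT2 (vec_space m'))%type : measurableType _)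
  end.

Definition vec m : measurableType (projT1 (vec_space m)) := projT2 (vec_space m).

Fixpoint entry m : vec m -> nat -> R :=
  match m return vec m -> nat -> R with
  | 0 => fun _ _ => 0%R
  | m'.+1 => fun x k => if k is k'.+1 then @entry m' x.2 k' else x.1
  end.

Fixpoint vec_of m (f : nat -> R) : vec m :=
  match m return vec m with
  | 0 => tt
  | m'.+1 => (f 0%N, vec_of m' (fun k => f k.+1))
  end.

Lemma entry_vec_of m f k : (k < m)%N -> entry (vec_of m f) k = f k.
Proof. by elim: m f k => [|m IH] f [|k]//= km; rewrite IH. Qed.

Definition dot m (x y : vec m) : R := (\sum_(i < m) entry x i * entry y i)%R.

Lemma dot0 (x y : vec 0) : dot x y = 0%R.
Proof. by rewrite /dot big_ord0. Qed.

Lemma dotS m (x y : vec m.+1) : (dot x y = x.1 * y.1 + dot (x.2 : vec m) y.2)%R.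
Proof. by rewrite /dot big_ord_recl. Qed.

Lemma dot_ge0 m (x : vec m) : (0 <= dot x x)%R.
Proof. by apply: sumr_ge0 => i _; rewrite -expr2 sqr_ge0. Qed.

Lemma dotC m (x y : vec m) : dot x y = dot y x.
Proof. by apply: eq_bigr => i _; rewrite mulrC. Qed.

Lemma measurable_entry m k : measurable_fun setT (fun x : vec m => entry x k).
Proof.
elim: m k => [|m IH] k; first exact: measurable_cst.
case: k => [|k]; first exact: (@measurable_fst _ _ R (vec m)).
by apply: (measurableT_comp (IH k)); exact: (@measurable_snd _ _ R (vec m)).
Qed.

Lemma measurable_dot m (z : vec m) : measurable_fun setT (dot z).
Proof.
rewrite /dot; apply: measurable_sum => i.
by apply: measurable_funM => //; exact: measurable_entry.
Qed.

Fixpoint prod_prob n (mu : nat -> probability R R) : probability (vec n) R :=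
  match n return probability (vec n) R with
  | 0 => (dirac tt : probability unit R)
  | n'.+1 => (mu 0%N \x prod_prob n' (fun k => mu k.+1)
                : probability (R * vec n')%type R)
  end.

Lemma integral_prod_prob0 (mu : nat -> probability R R) (h : vec 0 -> \bar R) :
  \int[prod_prob 0 mu]_x h x = h tt.
Proof. by rewrite integral_dirac// diracT mul1e. Qed.

Lemma integral_prod_probS n (mu : nat -> probability R R) (h : vec n.+1 -> \bar R) :
  measurable_fun setT h -> (forall x, 0 <= h x) ->
  \int[prod_prob n.+1 mu]_x h x =
  \int[mu 0%N]_x \int[prod_prob n (fun k => mu k.+1)]_y h (x, y).
Proof. by move=> mh h0; rewrite /= fubini_tonelli1. Qed.

Lemma measurable_prod_prob_inner n (nu : probability (vec n) R)
    (h : vec n.+1 -> \bar R) :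
  measurable_fun setT h -> (forall x, 0 <= h x) ->
  measurable_fun [set: R] (fun x => \int[nu]_y h (x, y)).
Proof. move=> mh h0; exact: (measurable_fun_fubini_tonelli_F (m2 := nu) h mh h0). Qed.

Lemma measurable_vec_section n (h : vec n.+1 -> \bar R) x :
  measurable_fun setT h -> measurable_fun [set: vec n] (fun y => h (x, y)).
Proof. by move=> mh; apply: (measurableT_comp mh); exact: (@pair1_measurable _ _ R (vec n)). Qed.

End iterated_products.

Section gaussian_rotations.
Context {R : realType}.
Local Notation V m := (@vec R m).
Local Open Scope ereal_scope.

Definition gaussN m : probability (V m) R := prod_prob m (fun=> @gauss R).

Lemma integral_gaussNS m (h : V m.+1 -> \bar R) :
  measurable_fun setT h -> (forall x, 0 <= h x) ->
  \int[gaussN m.+1]_x h x = \int[@gauss R]_x \int[gaussN m]_y h (x, y).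
Proof. exact: integral_prod_probS. Qed.

(* [O'] is the transpose of the orthogonal map [O]. *)
Definition gauss_isometry m (O O' : V m -> V m) :=
  [/\ measurable_fun setT O,
      forall z g, dot z (O g) = dot (O' z) g,
      forall z, dot (O z) (O z) = dot z z,
      forall z, dot (O' z) (O' z) = dot z z &
      forall h : V m -> \bar R, measurable_fun setT h -> (forall x, 0 <= h x) ->
        \int[gaussN m]_g h (O g) = \int[gaussN m]_g h g].

Lemma gauss_isometry_id m : @gauss_isometry m id id.
Proof. by split => //; exact: measurable_id. Qed.

Lemma gauss_isometry_comp m (O1 O1' O2 O2' : V m -> V m) :
  gauss_isometry O1 O1' -> gauss_isometry O2 O2' ->
  gauss_isometry (O1 \o O2) (O2' \o O1').
Proof.
move=> [m1 t1 n1 n1' i1] [m2 t2 n2 n2' i2]; split => //=.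
- exact: measurableT_comp.
- by move=> z g; rewrite t1 t2.
- by move=> z; rewrite n1 n2.
- by move=> z; rewrite n2' n1'.
- move=> h mh h0; rewrite (i2 (fun g => h (O1 g))) ?i1//.
  exact: measurableT_comp.
Qed.

Lemma gauss_isometry_tail m (O O' : V m -> V m) : gauss_isometry O O' ->
  @gauss_isometry m.+1 (fun g => (g.1, O g.2)) (fun g => (g.1, O' g.2)).
Proof.
move=> [mO t n n' i].
have mO1 : @measurable_fun _ _ (V m.+1) (V m.+1) setT (fun g => (g.1, O g.2)).
  apply: (@measurable_fun_pair _ _ _ _ R (V m)).
    exact: (@measurable_fst _ _ R (V m)).
  by apply: measurableT_comp => //; exact: (@measurable_snd _ _ R (V m)).
split => //.
- by move=> z g; rewrite !dotS/= t.
- by move=> z; rewrite !dotS/= n.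
- by move=> z; rewrite !dotS/= n'.
- move=> h mh h0.
  rewrite integral_gaussNS//; last exact: measurableT_comp.
  rewrite integral_gaussNS//; apply: eq_integral => x _ /=.
  by rewrite (i (fun y => h (x, y)))//; exact: measurable_vec_section.
Qed.

Lemma gauss_isometry_plane m (c s : R) : (s != 0)%R -> (c ^+ 2 + s ^+ 2 = 1)%R ->
  @gauss_isometry m.+2
    (fun g => (c * g.1 - s * g.2.1, (s * g.1 + c * g.2.1, g.2.2)))%R
    (fun g => (c * g.1 + s * g.2.1, (- s * g.1 + c * g.2.1, g.2.2)))%R.
Proof.
move=> s0 cs.
have m1 : measurable_fun [set: V m.+2] (fun g : V m.+2 => g.1).
  exact: (@measurable_entry _ m.+2 0).
have m2 : measurable_fun [set: V m.+2] (fun g : V m.+2 => g.2.1).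
  exact: (@measurable_entry _ m.+2 1).
have m3 : measurable_fun [set: V m.+2] (fun g : V m.+2 => g.2.2 : V m).
  apply: (measurableT_comp (@measurable_snd _ _ R (V m))).
  exact: (@measurable_snd _ _ R (V m.+1)).
have mO : @measurable_fun _ _ (V m.+2) (V m.+2) setT
    (fun g => (c * g.1 - s * g.2.1, (s * g.1 + c * g.2.1, g.2.2)))%R.
  apply: (@measurable_fun_pair _ _ _ _ R (V m.+1)).
    by apply: measurable_funB; exact: measurable_funM.
  apply: (@measurable_fun_pair _ _ _ _ R (V m)) => //.
  by apply: measurable_funD; exact: measurable_funM.
split => //.
- by move=> z g; rewrite !dotS/=; ring.
- move=> z; rewrite !dotS/=.
  transitivity ((c ^+ 2 + s ^+ 2) * (z.1 * z.1 + z.2.1 * z.2.1) +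
    dot (z.2.2 : V m) z.2.2)%R; first by ring.
  by rewrite cs mul1r addrA.
- move=> z; rewrite !dotS/=.
  transitivity ((c ^+ 2 + s ^+ 2) * (z.1 * z.1 + z.2.1 * z.2.1) +
    dot (z.2.2 : V m) z.2.2)%R; first by ring.
  by rewrite cs mul1r addrA.
- move=> h mh h0.
  pose H (z : R * R) := \int[gaussN m]_r h (z.1, (z.2, r)).
  have mH : measurable_fun setT H.
    pose k (z : (R * R) * V m) := h (z.1.1, (z.1.2, z.2)).
    have mk : measurable_fun setT k.
      apply: (measurableT_comp mh).
      apply: (@measurable_fun_pair _ _ _ _ R (V m.+1)).
        exact: (measurableT_comp measurable_fst measurable_fst).
      apply: (@measurable_fun_pair _ _ _ _ R (V m)).
        exact: (measurableT_comp measurable_snd measurable_fst).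
      exact: measurable_snd.
    have k0 z : 0 <= k z by exact: h0.
    exact: (measurable_fun_fubini_tonelli_F (m2 := gaussN m) k mk k0).
  have H0 z : 0 <= H z by apply: integral_ge0.
  have E (h' : V m.+2 -> \bar R) : measurable_fun setT h' -> (forall x, 0 <= h' x) ->
      \int[gaussN m.+2]_g h' g = \int[@gauss R]_x \int[@gauss R]_y
        \int[gaussN m]_r h' (x, (y, r)).
    move=> mh' h'0; rewrite integral_gaussNS//; apply: eq_integral => x _.
    by rewrite integral_gaussNS//; exact: measurable_vec_section.
  rewrite E//; last exact: measurableT_comp.
  rewrite (E h mh h0).
  exact: (@integral2_gauss_rotation R c s H s0 cs mH H0).
Qed.

(** Givens rotations: the tail is aligned recursively, then a rotation of the first two coordinates
    clears what remains. [gauss_isometry_plane] asks for a nonzero sine, hence the separate case of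
    a tail that is already zero. *)
Lemma gauss_align m (a : V m.+1) : exists O O' : V m.+1 -> V m.+1,
  gauss_isometry O O' /\ exists s : R, O' a = (s, vec_of m (fun=> 0%R)).
Proof.
elim: m a => [|m IH] [x a].
  by exists id, id; split; [exact: gauss_isometry_id|exists x; case: a].
have [U [U' [isoO1 [s1 E1]]]] := IH a.
have isoO := gauss_isometry_tail isoO1.
have [s10|s10] := eqVneq s1 0%R.
  exists (fun g : V m.+2 => (g.1, U g.2)), (fun g : V m.+2 => (g.1, U' g.2)).
  by split => //; exists x; rewrite /= E1 s10.
pose r := Num.sqrt (x ^+ 2 + s1 ^+ 2).
have r2 : (r ^+ 2 = x ^+ 2 + s1 ^+ 2)%R by rewrite sqr_sqrtr// addr_ge0 ?sqr_ge0.
have r0 : (r != 0)%R.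
  rewrite -sqrf_eq0 r2 paddr_eq0 ?sqr_ge0// !sqrf_eq0 (negbTE s10) andbF//.
have cs : ((x / r) ^+ 2 + (s1 / r) ^+ 2 = 1)%R.
  by rewrite !expr_div_n -mulrDl -r2 mulfV// sqrf_eq0.
have s0 : (s1 / r != 0)%R by rewrite mulf_neq0// invr_eq0.
have isoP := @gauss_isometry_plane m _ _ s0 cs.
eexists; eexists; split; first exact: (gauss_isometry_comp isoO isoP).
exists r; rewrite /= E1/=; congr (_, (_, _)).
- transitivity ((x ^+ 2 + s1 ^+ 2) / r)%R; first by field.
  by rewrite -r2; field.
- by field.
Qed.

End gaussian_rotations.

(** * Weighted Hoelder inequality and rank-one Gaussian Brascamp-Lieb inequality *)

Section powR_complements.
Context {R : realType}.

Lemma powRD_ge0 (x r s : R) : 0 <= r -> 0 <= s -> x `^ (r + s) = x `^ r * x `^ s.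
Proof.
move=> r0 s0; have [->|x0] := eqVneq x 0; last by rewrite powRD// x0 implybT.
have [->|r1] := eqVneq r 0; first by rewrite add0r powRr0 mul1r.
have rs : r + s != 0 by rewrite gt_eqF// ltr_pwDl// lt_neqAle eq_sym r1.
by rewrite (powR0 rs) (powR0 r1) mul0r.
Qed.

Lemma powRV (x r : R) : 0 <= x -> x^-1 `^ r = (x `^ r)^-1.
Proof. by move=> x0; rewrite -powR_inv1// -powRrM mulN1r powRN. Qed.

Lemma powR_amgm (x y p : R) : 0 <= x -> 0 <= y -> 0 < p -> p < 1 ->
  x `^ p * y `^ (1 - p) <= p * x + (1 - p) * y.
Proof.
move=> x0 y0 p0 p1; have q0 : 0 < 1 - p by rewrite subr_gt0.
have /= := @conjugate_powR R (x `^ p) (y `^ (1 - p)) p^-1 (1 - p)^-1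
  (powR_ge0 _ _) (powR_ge0 _ _).
have pq : p^-1^-1 + (1 - p)^-1^-1 = 1 by rewrite !invrK addrC subrK.
rewrite !invr_gt0 => /(_ p0 q0 pq); rewrite !invrK.
by rewrite -!powRrM !mulfV ?gt_eqF// !powRr1// (mulrC x) (mulrC y).
Qed.

Lemma powR_prod (I : Type) (s : seq I) (f : I -> R) (p : R) :
  (forall i, 0 <= f i) -> (\prod_(i <- s) f i) `^ p = \prod_(i <- s) f i `^ p.
Proof.
move=> f0; elim: s => [|i s IH]; first by rewrite !big_nil powR1.
by rewrite !big_cons powRM ?IH// prodr_ge0.
Qed.

End powR_complements.

Section weighted_holder.
Context d (T : measurableType d) {R : realType}.
Local Open Scope ereal_scope.

(** Hoelder's inequality with upper bounds [u], [w] in place of the integrals: weighted AM-GM is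
    applied pointwise to [U / u] and [W / w], then integrated. *)
Lemma integral_powR_mul (m : {measure set T -> \bar R}) (U W : T -> R) (u w p : R) :
  measurable_fun setT U -> measurable_fun setT W ->
  (forall x, 0 <= U x)%R -> (forall x, 0 <= W x)%R ->
  (0 < u)%R -> (0 < w)%R -> (0 < p)%R -> (p < 1)%R ->
  \int[m]_x (U x)%:E <= u%:E -> \int[m]_x (W x)%:E <= w%:E ->
  \int[m]_x (U x `^ p * W x `^ (1 - p))%:E <= (u `^ p * w `^ (1 - p))%:E.
Proof.
move=> mU mW U0 W0 u0 w0 p0 p1 intU intW.
have q0 : (0 < 1 - p)%R by rewrite subr_gt0.
pose k := (u `^ p * w `^ (1 - p))%R.
have k0 : (0 <= k)%R by rewrite mulr_ge0 ?powR_ge0.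
have mUE : measurable_fun setT (EFin \o U) by exact/measurable_EFinP.
have mWE : measurable_fun setT (EFin \o W) by exact/measurable_EFinP.
apply: (@le_trans _ _ (\int[m]_x (k%:E * ((p / u)%:E * (U x)%:E + ((1 - p) / w)%:E * (W x)%:E)))).
  apply: ge0_le_integral => //.
  - by move=> x _; rewrite lee_fin mulr_ge0 ?powR_ge0.
  - apply/measurable_EFinP; apply: measurable_funM.
      exact: (measurableT_comp (measurable_powR p) mU).
    exact: (measurableT_comp (measurable_powR (1 - p)) mW).
  - by apply/measurable_funeM/emeasurable_funD; exact: measurable_funeM.
  - move=> x _; rewrite -(EFinM (p / u)) -(EFinM ((1 - p) / w)) -EFinD -EFinM lee_fin.
    have := @powR_amgm R (U x / u) (W x / w) p.
    rewrite !divr_ge0 ?(ltW u0) ?(ltW w0)// => /(_ isT isT p0 p1) H.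
    apply: (@le_trans _ _ (k * ((U x / u) `^ p * (W x / w) `^ (1 - p)))%R).
      rewrite !powRM ?invr_ge0 ?(ltW u0) ?(ltW w0)// /k.
      rewrite !powRV ?(ltW u0) ?(ltW w0)//.
      have := powR_gt0 p u0; have := powR_gt0 (1 - p) w0 => ? ?.
      rewrite [leRHS](_ : _ = U x `^ p * W x `^ (1 - p))%R//.
      by field; rewrite !gt_eqF.
    rewrite ler_wpM2l//; apply: le_trans H _.
    by rewrite le_eqVlt; apply/orP; left; apply/eqP; field; rewrite !gt_eqF.
rewrite ge0_integralZl//; last 2 first.
- by apply: emeasurable_funD; exact: measurable_funeM.
- move=> x _; rewrite adde_ge0// mule_ge0// lee_fin// divr_ge0//; exact: ltW.
rewrite ge0_integralD//; last 4 first.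
- by move=> x _; rewrite mule_ge0// lee_fin// divr_ge0//; exact: ltW.
- exact: measurable_funeM.
- by move=> x _; rewrite mule_ge0// lee_fin// divr_ge0//; exact: ltW.
- exact: measurable_funeM.
rewrite !ge0_integralZl//; last 4 first.
- by move=> x _; rewrite lee_fin.
- by rewrite lee_fin divr_ge0//; exact: ltW.
- by move=> x _; rewrite lee_fin.
- by rewrite lee_fin divr_ge0//; exact: ltW.
rewrite -[leRHS]mule1; apply: lee_wpmul2l => //.
apply: (@le_trans _ _ ((p / u)%:E * u%:E + ((1 - p) / w)%:E * w%:E)).
  apply: leeD; apply: lee_wpmul2l => //; rewrite lee_fin divr_ge0//; exact: ltW.
by rewrite -!EFinM -EFinD lee_fin !divfK ?gt_eqF// addrC subrK.
Qed.

End weighted_holder.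

Section brascamp_lieb.
Context {R : realType}.
Local Notation V m := (@vec R m).
Variables (F : nat -> R -> R) (b : nat -> R) (D : R).
Hypothesis D0 : 0 < D.
Hypothesis mF : forall j, measurable_fun [set: R] (F j).
Hypothesis F0 : forall j x, 0 <= F j x.
Hypothesis b0 : forall j, 0 < b j.
(** The factor [|s|] makes the estimate scale-free, and uniformity in [v] allows the other Gaussian
    coordinates to be frozen. *)
Hypothesis F_gauss : forall j s v,
  (`|s|%:E * \int[@gauss R]_x (F j (s * x + v))%:E <= (D * Num.sqrt (b j))%:E)%E.

(** The exponents [e] are kept apart from the vectors because in the interpolation step they differ
    from the squared lengths. *)
Let prodF n m (a : nat -> V m) (v e : nat -> R) (g : V m) : R :=
  \prod_(j < n) F j (dot (a j) g + v j) `^ e j.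

Let bound n (e : nat -> R) : R := \prod_(j < n) (D `^ e j * expR (b j / 2)).

Let prodF_ge0 n m (a : nat -> V m) v e g : 0 <= prodF n a v e g.
Proof. by apply: prodr_ge0 => j _; exact: powR_ge0. Qed.

Let measurable_prodF n m (a : nat -> V m) v e : measurable_fun setT (prodF n a v e).
Proof.
apply: measurable_prod => j _.
apply: (measurableT_comp (measurable_powR _)).
apply: (measurableT_comp (mF j)).
by apply: measurable_funD => //; exact: measurable_dot.
Qed.

Let bound_gt0 n e : 0 < bound n e.
Proof. by apply: prodr_gt0 => j _; rewrite mulr_gt0 ?expR_gt0 ?powR_gt0. Qed.

Let sqrt_le_expR_half (x : R) : 0 < x -> Num.sqrt x <= expR (x / 2).
Proof.
move=> x0; rewrite -(@ler_pXn2r _ 2) ?nnegrE ?sqrtr_ge0 ?expR_ge0//.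
rewrite sqr_sqrtr ?(ltW x0)// expr2 -expRD -splitr.
by apply: le_trans _ (expR_ge1Dx x); rewrite lerDr.
Qed.

(* This is where the entropy loss appears: by AM-GM the left side is at most
   [sqrt ((p b + 1 - p) + 2 sqrt (p b (1 - p))) <= sqrt (1 + b)]. *)
Let entropy_loss (s x : R) : s ^+ 2 < 1 -> s != 0 -> 0 < x ->
  (Num.sqrt x / `|s|) `^ (s ^+ 2) * ((Num.sqrt (1 - s ^+ 2))^-1) `^ (1 - s ^+ 2)
  <= expR (x / 2).
Proof.
move=> s1 s0 x0; have p0 : 0 < s ^+ 2 by rewrite exprn_even_gt0.
have q0 : 0 < 1 - s ^+ 2 by rewrite subr_gt0.
set t := Num.sqrt (1 - s ^+ 2); have t0 : 0 < t by rewrite sqrtr_gt0.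
have t2 : t ^+ 2 = 1 - s ^+ 2 by rewrite sqr_sqrtr// ltW.
set r := Num.sqrt x; have r0 : 0 < r by rewrite sqrtr_gt0.
have r2 : r ^+ 2 = x by rewrite sqr_sqrtr// ltW.
have n0 : 0 < `|s| by rewrite normr_gt0.
have n2 : `|s| ^+ 2 = s ^+ 2 by rewrite real_normK ?num_real.
have h1 : 0 <= r / `|s| by rewrite divr_ge0// ltW.
have h2 : 0 <= t^-1 by rewrite invr_ge0 ltW.
apply: le_trans (powR_amgm h1 h2 p0 s1) _.
rewrite -t2 -n2.
rewrite [leLHS](_ : _ = `|s| * r + t); last by field; rewrite !gt_eqF.
rewrite -(@ler_pXn2r _ 2) ?nnegrE ?expR_ge0//; last first.
  by rewrite addr_ge0 ?mulr_ge0// ltW.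
rewrite [leRHS]expr2 -expRD -splitr; apply: le_trans _ (expR_ge1Dx x).
(* This gives [2 |s| r t <= s^2 + r^2 t^2]; with [s^2 + t^2 = 1], the square of [|s| r + t] is then
   at most [1 + r^2]. *)
have : 0 <= (`|s| - r * t) ^+ 2 by exact: sqr_ge0.
rewrite -r2; move: t2; rewrite -n2; nra.
Qed.

(* With [p = |a n|^2] and [B j] the part of [a j] orthogonal to [a n], the product
   is [U `^ p * W `^ (1 - p)]: in [U] the factor [n] has exponent [1] and the others
   [|B j|^2], in [W] the factor [n] is absent and the direction of [a n] is dilated
   by [c = (1 - p)^(-1/2)]. *)
Let aligned_step n m (a : nat -> V m.+1) (v : nat -> R) (s : R) :
  (forall m' (a' : nat -> V m') v',
    (forall y, \sum_(j < n) dot (a' j) y ^+ 2 <= dot y y) ->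
    (\int[gaussN m']_g (prodF n a' v' (fun j => dot (a' j) (a' j)) g)%:E <=
      (bound n (fun j => dot (a' j) (a' j)))%:E)%E) ->
  s != 0 -> a n = (s, vec_of m (fun=> 0)) ->
  (forall y, \sum_(j < n.+1) dot (a j) y ^+ 2 <= dot y y) ->
  (\int[gaussN m.+1]_g (prodF n.+1 a v (fun j => dot (a j) (a j)) g)%:E <=
    (bound n.+1 (fun j => dot (a j) (a j)))%:E)%E.
Proof.
move=> IH s0 anE ha.
have dz (y : V m) : dot (vec_of m (fun=> 0)) y = 0.
  by rewrite /dot big1// => i _; rewrite entry_vec_of// mul0r.
pose al j : R := (a j).1; pose B j : V m := (a j).2.
have dE j (g : V m.+1) : dot (a j) g = al j * g.1 + dot (B j) g.2 by rewrite dotS.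
have dnE (g : V m.+1) : dot (a n) g = s * g.1 by rewrite anE dotS/= dz addr0.
have annE : dot (a n) (a n) = s ^+ 2 by rewrite dnE anE.
have ajE j : dot (a j) (a j) = al j ^+ 2 + dot (B j) (B j) by rewrite dE.
set p := s ^+ 2 in annE.
have p0 : 0 < p by rewrite /p exprn_even_gt0.
have hB (y : V m) : \sum_(j < n) dot (B j) y ^+ 2 <= dot y y.
  have := ha ((0, y) : V m.+1); rewrite [leRHS]dotS/= mul0r add0r.
  rewrite big_ord_recr/= dnE mulr0 expr0n addr0.
  by under eq_bigr do rewrite dE/= mulr0 add0r.
have hx x : \sum_(j < n) (al j * x) ^+ 2 + (s * x) ^+ 2 <= x ^+ 2.
  have := ha ((x, vec_of m (fun=> 0)) : V m.+1).
  rewrite [leRHS]dotS/= dz addr0 big_ord_recr/= dnE -expr2.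
  by under eq_bigr do rewrite dE/= dotC dz addr0.
have p1 : p <= 1.
  have := hx 1; rewrite mulr1 expr1n; apply: le_trans.
  by rewrite lerDr sumr_ge0// => j _; rewrite sqr_ge0.
have Fn_le w : (\int[@gauss R]_x (F n (s * x + w))%:E <=
    (D * Num.sqrt (b n) / `|s|)%:E)%E.
  by rewrite [(D * _ / _)%R]mulrC EFinM lee_pdivlMl ?normr_gt0//.
have mFn w : measurable_fun [set: R] (fun x => F n (s * x + w)).
  apply: (measurableT_comp (mF n)).
  by apply: measurable_funD => //; exact: measurable_funM.
(* At a fixed first coordinate [x] the terms [al j * x] are mere shifts, over which the induction
   hypothesis is uniform; the factor [n] is then integrated on the line alone. *)
have branch1 :
  (\int[gaussN m.+1]_g (F n (s * g.1 + v n) *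
      prodF n a v (fun j => dot (B j) (B j)) g)%:E <=
    (D * Num.sqrt (b n) / `|s| * bound n (fun j => dot (B j) (B j)))%:E)%E.
  have mk : measurable_fun [set: V m.+1] (fun g => (F n (s * g.1 + v n) *
      prodF n a v (fun j => dot (B j) (B j)) g)%:E).
    apply/measurable_EFinP; apply: measurable_funM => //.
    by apply: (measurableT_comp (mFn _)); exact: (@measurable_entry _ m.+1 0).
  rewrite integral_gaussNS//; last by move=> g; rewrite lee_fin mulr_ge0.
  apply: (@le_trans _ _ (\int[@gauss R]_x ((F n (s * x + v n))%:E *
      (bound n (fun j => dot (B j) (B j)))%:E))%E).
    apply: ge0_le_integral => //.
    - by move=> x _; apply: integral_ge0 => y _; rewrite lee_fin mulr_ge0.
    - apply: (measurable_prod_prob_inner _ mk) => g.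
      by rewrite lee_fin mulr_ge0.
    - by apply/measurable_EFinP; exact: measurable_funM.
    - move=> x _ /=.
      under eq_integral do rewrite EFinM.
      rewrite ge0_integralZl ?lee_fin//; last 2 first.
      + apply/measurable_EFinP.
        apply: (measurableT_comp (measurable_prodF n a v _)).
        exact: (@pair1_measurable _ _ R (V m)).
      + by move=> y _; rewrite lee_fin.
      rewrite lee_wpmul2l ?lee_fin//.
      have := IH m B (fun j => al j * x + v j) hB.
      apply: le_trans; rewrite le_eqVlt; apply/orP; left; apply/eqP.
      apply: eq_integral => y _; congr EFin; apply: eq_bigr => j _.
      by rewrite dE/= [_ + dot _ _]addrC addrA.
  rewrite ge0_integralZr//; last 3 first.
  - exact/measurable_EFinP.
  - by move=> x _; rewrite lee_fin.
  - by rewrite lee_fin ltW.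
  by rewrite EFinM; apply: lee_wpmul2r; rewrite ?lee_fin// ltW.
have boundS e : bound n.+1 e = bound n e * (D `^ e n * expR (b n / 2)).
  by rewrite /bound big_ord_recr.
have prodFS e g : prodF n.+1 a v e g = prodF n a v e g * F n (s * g.1 + v n) `^ e n.
  by rewrite /prodF big_ord_recr/= dnE.
move: p1; rewrite le_eqVlt => /orP[/eqP p1|p1].
  (* [a n] is orthogonal to the other vectors *)
  have al0 j : (j < n)%N -> al j = 0.
    move=> jn; have := hx 1; rewrite mulr1 -/p p1 expr1n gerDr => h.
    have /eqP : \sum_(j < n) (al j * 1) ^+ 2 = 0.
      by apply/eqP; rewrite eq_le h sumr_ge0// => i _; rewrite sqr_ge0.
    rewrite psumr_eq0; last by move=> i _; rewrite sqr_ge0.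
    by move=> /allP/(_ (Ordinal jn) (mem_index_enum _)); rewrite mulr1 sqrf_eq0 => /eqP.
  have eE j : (j < n)%N -> dot (a j) (a j) = dot (B j) (B j).
    by move=> jn; rewrite ajE al0// expr0n add0r.
  have s1 : `|s| = 1.
    by apply/eqP; rewrite -sqrp_eq1// real_normK ?num_real//; apply/eqP.
  rewrite boundS annE p1 powRr1 ?(ltW D0)//.
  have -> : bound n (fun j => dot (a j) (a j)) = bound n (fun j => dot (B j) (B j)).
    by apply: eq_bigr => j _; rewrite eE.
  apply: (@le_trans _ _ ((D * Num.sqrt (b n) / `|s| *
      bound n (fun j => dot (B j) (B j)))%:E)%E).
    apply: le_trans _ branch1; rewrite le_eqVlt; apply/orP; left; apply/eqP.
    apply: eq_integral => g _; rewrite prodFS annE p1 powRr1// mulrC.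
    by congr (_ * _)%:E; apply: eq_bigr => j _; rewrite eE.
  rewrite lee_fin s1 divr1 mulrC ler_pM2l// ler_pM2l//.
  exact: sqrt_le_expR_half.
have q0 : 0 < 1 - p by rewrite subr_gt0.
pose c := (Num.sqrt (1 - p))^-1.
have c2 : c ^+ 2 = (1 - p)^-1 by rewrite exprVn sqr_sqrtr// ltW.
have c0 : 0 < c by rewrite invr_gt0 sqrtr_gt0.
have c1 : 1 <= c.
  rewrite -(@ler_pXn2r _ 2) ?nnegrE ?(ltW c0)// c2 expr1n invf_ge1//.
  by rewrite gerBl ltW.
(* Chosen so that [|a j|^2 = p |B j|^2 + (1 - p) e j]; it is also the squared length of [a j] once
   its first coordinate is dilated by [c]. *)
pose e j := al j ^+ 2 / (1 - p) + dot (B j) (B j).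
have branch0 : (\int[gaussN m.+1]_g (prodF n a v e g)%:E <= (c * bound n e)%:E)%E.
  have mk : measurable_fun [set: V m.+1] (fun g => (prodF n a v e g)%:E).
    exact/measurable_EFinP.
  rewrite integral_gaussNS//; last by move=> g; rewrite lee_fin.
  pose H x := (\int[gaussN m]_y (prodF n a v e (x, y))%:E)%E.
  have mH : measurable_fun [set: R] H.
    by apply: (measurable_prod_prob_inner _ mk) => g; rewrite lee_fin.
  have H0 x : (0 <= H x)%E by apply: integral_ge0 => y _; rewrite lee_fin.
  apply: le_trans (integral_gauss_dilate c1 mH H0) _.
  rewrite EFinM; apply: lee_wpmul2l; first by rewrite lee_fin ltW.
  pose a' j : V m.+1 := (c * al j, B j).
  have a'E j : dot (a' j) (a' j) = e j.
    by rewrite dotS/= -expr2 exprMn c2 mulrC.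
  (* In the frame condition at [y'], moving the term of [a n] to the right subtracts [p c^2 y.1^2];
     as [(1 - p) c^2 = 1], exactly [dot y y] is left. *)
  have ha' (y : V m.+1) : \sum_(j < n) dot (a' j) y ^+ 2 <= dot y y.
    pose y' : V m.+1 := (c * y.1, y.2).
    have a'y j : dot (a' j) y = dot (a j) y' by rewrite dE dotS/= mulrCA mulrA.
    have := ha y'; rewrite big_ord_recr/= dnE [dot y' y']dotS [dot y y]dotS/=.
    under [in X in _ -> X]eq_bigr do rewrite a'y.
    rewrite -!expr2 !exprMn -/p c2 -lerBrDr => /le_trans; apply.
    rewrite le_eqVlt; apply/orP; left; apply/eqP.
    by field; rewrite gt_eqF.
  have bE : bound n (fun j => dot (a' j) (a' j)) = bound n e.
    by apply: eq_bigr => j _; rewrite a'E.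
  have IHa' := IH _ a' v ha'; rewrite bE in IHa'.
  apply: le_trans _ IHa'; rewrite le_eqVlt; apply/orP; left; apply/eqP.
  have mk' : measurable_fun setT
      (fun g => (prodF n a' v (fun j => dot (a' j) (a' j)) g)%:E).
    exact/measurable_EFinP.
  have k'0 g : (0 <= (prodF n a' v (fun j => dot (a' j) (a' j)) g)%:E)%E.
    by rewrite lee_fin.
  rewrite (integral_gaussNS mk' k'0).
  apply: eq_integral => x _; apply: eq_integral => y _; congr EFin.
  by apply: eq_bigr => j _; rewrite a'E dE dotS/= mulrCA mulrA.
have eE j : dot (a j) (a j) = p * dot (B j) (B j) + (1 - p) * e j.
  by rewrite ajE /e; field; rewrite gt_eqF.
have e0 j : 0 <= e j by rewrite addr_ge0 ?dot_ge0 ?divr_ge0 ?sqr_ge0// ltW.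
have q0' := ltW q0; have p0' := ltW p0.
have d0 j : 0 <= dot (B j) (B j) by exact: dot_ge0.
have u0 : 0 < D * Num.sqrt (b n) / `|s| * bound n (fun j => dot (B j) (B j)).
  by rewrite mulr_gt0// divr_gt0 ?normr_gt0// mulr_gt0// sqrtr_gt0.
have w0 : 0 < c * bound n e by rewrite mulr_gt0.
have split_powR (x y z : R) : 0 <= y -> 0 <= z ->
    x `^ (p * y + (1 - p) * z) = (x `^ y) `^ p * (x `^ z) `^ (1 - p).
  move=> y0 z0.
  rewrite (powRD_ge0 _ (mulr_ge0 p0' y0) (mulr_ge0 q0' z0)).
  by rewrite ![_ * y]mulrC ![_ * z]mulrC !powRrM.
pose U (g : V m.+1) := F n (s * g.1 + v n) * prodF n a v (fun j => dot (B j) (B j)) g.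
have mU : measurable_fun setT U.
  apply: measurable_funM => //.
  by apply: (measurableT_comp (mFn _)); exact: (@measurable_entry _ m.+1 0).
have U0 g : 0 <= U g by rewrite mulr_ge0.
have H := integral_powR_mul mU (measurable_prodF n a v e) U0 (prodF_ge0 n a v e)
  u0 w0 p0 p1 branch1 branch0.
apply: (@le_trans _ _
    (\int[gaussN m.+1]_g (U g `^ p * prodF n a v e g `^ (1 - p))%:E)%E).
  rewrite le_eqVlt; apply/orP; left; apply/eqP.
  apply: eq_integral => g _; congr EFin; rewrite prodFS annE.
  rewrite /U powRM// [LHS]mulrC -[RHS]mulrA; congr (_ * _).
  rewrite /prodF !powR_prod; [|by move=> ?; exact: powR_ge0..].
  by rewrite -big_split/=; apply: eq_bigr => j _; rewrite eE split_powR.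
apply: le_trans H _; rewrite lee_fin boundS annE.
have -> : bound n (fun j => dot (a j) (a j)) =
    bound n (fun j => dot (B j) (B j)) `^ p * bound n e `^ (1 - p).
  rewrite /bound !powR_prod; [|by move=> ?; rewrite mulr_ge0 ?powR_ge0 ?expR_ge0..].
  rewrite -big_split/=; apply: eq_bigr => j _.
  rewrite !powRM ?powR_ge0 ?expR_ge0// eE split_powR// mulrACA; congr (_ * _).
  by rewrite -powRD_ge0// addrC subrK powRr1// expR_ge0.
have X0 : 0 <= Num.sqrt (b n) / `|s| by rewrite divr_ge0.
rewrite -[D * _ / _]mulrA !(@powRM _ (D * _)) ?mulr_ge0 ?(ltW (bound_gt0 _ _)) ?(ltW D0)//.
rewrite (powRM _ (ltW D0) X0) (powRM _ (ltW c0) (ltW (bound_gt0 _ _))).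
set X1 := bound _ _ `^ _; set X2 := bound _ _ `^ _; set X3 := D `^ _.
(* The bounds for the first [n] columns recombine without loss; the whole price of the step sits in
   the column [n]. *)
rewrite [leLHS](_ : _ = X1 * X2 * (X3 *
  ((Num.sqrt (b n) / `|s|) `^ p * c `^ (1 - p)))); last by ring.
do 2 (rewrite ler_wpM2l//; first by rewrite ?mulr_ge0 ?powR_ge0).
exact: entropy_loss.
Qed.

(** The induction on [n] runs over all dimensions at once, since one branch of [aligned_step] lowers
    the dimension. A zero [a n] has exponent [0], hence contributes the factor [1]. *)
Lemma gauss_brascamp_lieb n m (a : nat -> V m) (v : nat -> R) :
  (forall y, \sum_(j < n) dot (a j) y ^+ 2 <= dot y y) ->
  (\int[gaussN m]_g
     (\prod_(j < n) F j (dot (a j) g + v j) `^ dot (a j) (a j))%:E <=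
   (\prod_(j < n) (D `^ dot (a j) (a j) * expR (b j / 2)))%:E)%E.
Proof.
elim: n m a v => [|n IH] m a v ha.
  rewrite big_ord0; under eq_integral do rewrite big_ord0.
  by rewrite integral_cst// [X in (_ * X)%E](probability_setT (gaussN m)) mule1.
have han y : \sum_(j < n) dot (a j) y ^+ 2 <= dot y y.
  by apply: le_trans (ha y); rewrite big_ord_recr/= lerDl sqr_ge0.
have [p0|p0] := eqVneq (dot (a n) (a n)) 0.
  rewrite big_ord_recr/= p0 powRr0 mul1r.
  under eq_integral do rewrite big_ord_recr/= p0 powRr0 mulr1.
  apply: le_trans (IH m a v han) _; rewrite lee_fin ler_peMr//.
    exact: ltW (bound_gt0 n (fun j => dot (a j) (a j))).
  by rewrite -expR0 ler_expR divr_ge0// ltW.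
case: m a ha han p0 => [|m] a ha han p0; first by rewrite dot0 eqxx in p0.
have [Q [Q' [[mQ tQ nQ nQ' iQ] [s E]]]] := gauss_align (a n).
have s0 : s != 0.
  apply: contra_neq p0 => s0; rewrite -nQ' E s0 dotS/= mul0r add0r.
  by rewrite /dot big1// => i _; rewrite entry_vec_of// mul0r.
pose f g := (\prod_(j < n.+1) F j (dot (a j) g + v j) `^ dot (a j) (a j))%:E.
have mf : measurable_fun setT f.
  by apply/measurable_EFinP; exact: (measurable_prodF n.+1 a v (fun j => dot (a j) (a j))).
have f0 g : (0 <= f g)%E by rewrite lee_fin; exact: (prodF_ge0 n.+1 a v (fun j => dot (a j) (a j))).
rewrite -(iQ f mf f0).
pose aQ j := Q' (a j).
have haQ y : \sum_(j < n.+1) dot (aQ j) y ^+ 2 <= dot y y.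
  rewrite -nQ; apply: le_trans _ (ha (Q y)).
  rewrite le_eqVlt; apply/orP; left; apply/eqP.
  by apply: eq_bigr => j _; rewrite tQ.
have H := aligned_step v IH s0 (E : aQ n = _) haQ.
have bE : bound n.+1 (fun j => dot (aQ j) (aQ j)) =
    \prod_(j < n.+1) (D `^ dot (a j) (a j) * expR (b j / 2)).
  by apply: eq_bigr => j _; rewrite nQ'.
rewrite bE in H; apply: le_trans _ H.
rewrite le_eqVlt; apply/orP; left; apply/eqP.
by apply: eq_integral => g _; congr EFin; apply: eq_bigr => j _; rewrite tQ nQ'.
Qed.

End brascamp_lieb.

(** * Characteristic functions, in particular the Gaussian one *)

Lemma polar_coordinates {R : realType} (x y : R) : exists t,
  x = Num.sqrt (x ^+ 2 + y ^+ 2) * cos t /\ y = Num.sqrt (x ^+ 2 + y ^+ 2) * sin t.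
Proof.
set r := Num.sqrt _.
have r2 : r ^+ 2 = x ^+ 2 + y ^+ 2 by rewrite sqr_sqrtr// addr_ge0 ?sqr_ge0.
have [r0|r0] := eqVneq r 0.
  move: r2; rewrite r0 expr0n/= => /esym/eqP.
  rewrite paddr_eq0 ?sqr_ge0// !sqrf_eq0 => /andP[/eqP-> /eqP->].
  by exists 0; rewrite !mul0r.
have rp : 0 < r by rewrite lt_neqAle eq_sym r0 sqrtr_ge0.
have u1 : -1 <= x / r <= 1.
  rewrite -ler_norml normrM normfV (gtr0_norm rp) ler_pdivrMr// mul1r.
  rewrite -(@ler_pXn2r _ 2) ?nnegrE ?(ltW rp)// real_normK ?num_real// r2.
  by rewrite lerDl sqr_ge0.
have ca : cos (acos (x / r)) = x / r by rewrite acosK.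
have sa : r * sin (acos (x / r)) = `|y|.
  rewrite sin_acos// -(sqrtr_sqr y).
  transitivity (Num.sqrt (r ^+ 2) * Num.sqrt (1 - (x / r) ^+ 2)).
    by rewrite sqrtr_sqr gtr0_norm.
  rewrite -sqrtrM ?sqr_ge0//; congr Num.sqrt.
  rewrite mulrBr mulr1 expr_div_n mulrCA mulfV ?mulr1 ?sqrf_eq0//.
  by rewrite r2 addrAC subrr add0r.
have [y0|y0] := leP 0 y.
  exists (acos (x / r)); rewrite ca sa ger0_norm//.
  by rewrite mulrCA mulfV ?mulr1.
exists (- acos (x / r)); rewrite cosN sinN ca mulrN sa ltr0_norm// opprK.
by rewrite mulrCA mulfV ?mulr1.
Qed.

Section characteristic_function.
Context d {T : measurableType d} {R : realType}.
Variable P : probability T R.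
Local Open Scope ereal_scope.

Lemma prob_integrable (f : T -> R) (M : R) : measurable_fun setT f ->
  (forall x, `|f x| <= M)%R -> P.-integrable setT (EFin \o f).
Proof.
move=> mf fM; apply: measurable_bounded_integrable => //.
  by rewrite [X in X < _](probability_setT P) ltry.
exists M; split; first exact: num_real.
by move=> y /ltW My x _; exact: le_trans My.
Qed.

Lemma integral_prob_cst (r : \bar R) : \int[P]_x r = r.
Proof. by rewrite integral_cst// [X in _ * X](probability_setT P) mule1. Qed.

(** Real and imaginary parts of the characteristic function of [Y]; [char_sqr] is its squared
    modulus. *)
Definition char_cos (Y : T -> R) (t : R) : R := (\int[P]_x cos (t * Y x))%R.
Definition char_sin (Y : T -> R) (t : R) : R := (\int[P]_x sin (t * Y x))%R.

Definition char_sqr (Y : T -> R) (t : R) : R :=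
  (char_cos Y t ^+ 2 + char_sin Y t ^+ 2)%R.

Variable Y : T -> R.
Hypothesis mY : measurable_fun setT Y.

Let mcos t : measurable_fun setT (fun x => cos (t * Y x)).
Proof.
apply: measurableT_comp; last exact: measurable_funM.
by apply: continuous_measurable_fun; exact: continuous_cos.
Qed.

Let msin t : measurable_fun setT (fun x => sin (t * Y x)).
Proof.
apply: measurableT_comp; last exact: measurable_funM.
by apply: continuous_measurable_fun; exact: continuous_sin.
Qed.

Let icos t : P.-integrable setT (EFin \o (fun x => cos (t * Y x))).
Proof. by apply: (@prob_integrable _ 1%R) => // x; exact: cos_max. Qed.

Let isin t : P.-integrable setT (EFin \o (fun x => sin (t * Y x))).
Proof. by apply: (@prob_integrable _ 1%R) => // x; exact: sin_max. Qed.

Lemma integral_trig (r p q t : R) :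
  \int[P]_x (r + (p * cos (t * Y x) + q * sin (t * Y x)))%:E =
  (r + (p * char_cos Y t + q * char_sin Y t))%:E.
Proof.
have ip : P.-integrable setT (fun x => p%:E * (EFin \o (fun x => cos (t * Y x))) x).
  exact: integrableZl.
have iq : P.-integrable setT (fun x => q%:E * (EFin \o (fun x => sin (t * Y x))) x).
  exact: integrableZl.
under eq_integral do rewrite EFinD EFinD !EFinM.
rewrite integralD//; last 2 first.
- by apply: (@prob_integrable _ `|r|%R) => //; exact: measurable_cst.
- exact: integrableD.
rewrite integralD// !integralZl//; [|exact: isin|exact: icos].
rewrite integral_prob_cst.
rewrite !EFinD !EFinM /char_cos /char_sin /Rintegral !fineK//.
- exact: (integrable_fin_num _ (isin t)).
- exact: (integrable_fin_num _ (icos t)).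
Qed.

Lemma integral_1Dcos (t th : R) :
  \int[P]_x (1 + cos (t * Y x + th))%:E =
  (1 + (char_cos Y t * cos th - char_sin Y t * sin th))%:E.
Proof.
under eq_integral do rewrite cosD mulrC [(sin (_ * _) * _)%R]mulrC -mulNr.
by rewrite integral_trig; congr (_ + (_ + _))%:E; rewrite ?mulNr mulrC.
Qed.

(** Polar form of the characteristic function. As [psi] does not depend on [th], integrating one
    coordinate inside a cosine costs the modulus as a factor and shifts the phase of the rest. *)
Lemma char_phase t : exists psi, forall th,
  \int[P]_x (1 + cos (t * Y x + th))%:E =
  (1 + Num.sqrt (char_sqr Y t) * cos (th + psi))%:E.
Proof.
have [psi [hc hs]] := polar_coordinates (char_cos Y t) (char_sin Y t).
exists psi => th; rewrite integral_1Dcos; congr (_%:E).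
rewrite -/(char_sqr Y t) in hc hs; rewrite [in LHS]hc [in LHS]hs cosD.
by ring.
Qed.

Lemma char_sqr_ge0 t : (0 <= char_sqr Y t)%R.
Proof. by rewrite addr_ge0 ?sqr_ge0. Qed.

Lemma char_sqr_le1 t : (char_sqr Y t <= 1)%R.
Proof.
have [psi hpsi] := char_phase t.
(* At this phase the cosine in [hpsi] is [-1], so positivity bounds the modulus by [1]. *)
have : 0 <= \int[P]_x (1 + cos (t * Y x + (pi - psi)))%:E.
  by apply: integral_ge0 => x _; rewrite lee_fin -lerBlDl sub0r cos_geN1.
rewrite hpsi subrK cospi mulrN1 lee_fin subr_ge0 => h.
rewrite -(sqr_sqrtr (char_sqr_ge0 t)) -(expr1n _ 2).
by rewrite ler_pXn2r ?nnegrE// sqrtr_ge0.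
Qed.

Lemma char_cos_le1 t : (char_cos Y t <= 1)%R.
Proof.
have := char_sqr_le1 t; rewrite -[leRHS](expr1n _ 2) => h.
rewrite (le_trans (ler_norm _))// -(@ler_pXn2r _ 2) ?nnegrE//.
rewrite real_normK ?num_real//; apply: le_trans _ h.
by rewrite lerDl sqr_ge0.
Qed.

Lemma measurable_char_cos : measurable_fun [set: R] (char_cos Y).
Proof.
have -> : char_cos Y = (fun t => fine (\int[P]_x (1 + cos (t * Y x))%:E) - 1)%R.
  apply/funext => t.
  have := integral_1Dcos t 0; rewrite cos0 sin0 mulr1 mulr0 subr0.
  under eq_integral do rewrite addr0.
  by move=> ->/=; rewrite addrC addKr.
apply: measurable_funB => //; apply: measurableT_comp => //.
pose k (z : R * T) := (1 + cos (z.1 * Y z.2))%:E.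
have mk : measurable_fun setT k.
  apply/measurable_EFinP; apply: measurable_funD => //.
  apply: measurableT_comp.
    by apply: continuous_measurable_fun; exact: continuous_cos.
  by apply: measurable_funM => //; exact: measurableT_comp.
have k0 z : 0 <= k z by rewrite lee_fin -lerBlDl sub0r cos_geN1.
exact: (measurable_fun_fubini_tonelli_F (m2 := P) k mk k0).
Qed.

End characteristic_function.

Section gauss_char.
Context {R : realType}.
Local Notation V m := (@vec R m).

(* [gcos |z|] is the characteristic function of [gaussN m] at [z]. *)
Definition gcos (t : R) : R := char_cos (@gauss R) id t.

Lemma integral_gauss_opp (h : R -> \bar R) :
  measurable_fun [set: R] h -> (forall x, 0 <= h x)%E ->
  (\int[@gauss R]_x h (- x)%R = \int[@gauss R]_x h x)%E.
Proof.
move=> mh h0; have mhN : measurable_fun [set: R] (fun x => h (- x)).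
  by apply: (measurableT_comp mh).
rewrite !integral_gauss//.
pose k (x : R) := (h x * (gauss_pdf x)%:E)%E.
have mk : measurable_fun [set: R] k.
  apply: emeasurable_funM => //; apply/measurable_EFinP.
  exact: measurable_gauss_pdf.
have k0 x : (0 <= k x)%E by rewrite mule_ge0// lee_fin gauss_pdf_ge0.
rewrite -(integral_lebesgue_opp mk k0).
by apply: eq_integral => x _; congr (_ * _%:E)%E; rewrite !gauss_pdfE sqrrN.
Qed.

Lemma gauss_char_sin t : char_sin (@gauss R) id t = 0.
Proof.
have mid : measurable_fun [set: R] (@id R) by exact: measurable_id.
pose h (x : R) := (1 + sin (t * x))%:E.
have mh : measurable_fun [set: R] h.
  apply/measurable_EFinP; apply: measurable_funD => //; apply: measurableT_comp.
    by apply: continuous_measurable_fun; exact: continuous_sin.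
  exact: measurable_funM.
have h0 x : (0 <= h x)%E by rewrite lee_fin -lerBlDl sub0r sin_geN1.
have E1 : (\int[@gauss R]_x h x = (1 + char_sin (@gauss R) id t)%:E)%E.
  rewrite -[char_sin _ _ _]mul1r -[in RHS](add0r (1 * _)).
  rewrite -[in RHS](mul0r (char_cos (@gauss R) id t)) -integral_trig//.
  by apply: eq_integral => x _; rewrite mul0r add0r mul1r.
have E2 : (\int[@gauss R]_x h (- x)%R = (1 - char_sin (@gauss R) id t)%:E)%E.
  rewrite -[(- char_sin _ _ _)]mulN1r -[in RHS](add0r (-1 * _)).
  rewrite -[in RHS](mul0r (char_cos (@gauss R) id t)) -integral_trig//.
  by apply: eq_integral => x _; rewrite /h mul0r add0r mulrN sinN mulN1r.
have := integral_gauss_opp mh h0; rewrite E1 E2 => -[].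
by move: (char_sin _ _ _) => S e; clear -e; lra.
Qed.

(* Cosines are shifted by [1] so that Tonelli's theorem applies to them. *)
Lemma integral_gauss_1Dcos t th :
  (\int[@gauss R]_x (1 + cos (t * x + th))%:E = (1 + gcos t * cos th)%:E)%E.
Proof.
by rewrite integral_1Dcos ?gauss_char_sin ?mul0r ?subr0//; exact: measurable_id.
Qed.

Lemma gcosN t : gcos (- t) = gcos t.
Proof. by apply: eq_Rintegral => x _; rewrite mulNr cosN. Qed.

Lemma gcos_norm t : gcos `|t| = gcos t.
Proof. by case: (ger0P t) => // _; rewrite gcosN. Qed.

Lemma gcos0 : gcos 0 = 1.
Proof.
rewrite /gcos /char_cos /Rintegral.
under eq_integral do rewrite mul0r cos0.
by rewrite (integral_prob_cst (@gauss R)).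
Qed.

Lemma measurable_1Dcos d (T : measurableType d) (f : T -> R) :
  measurable_fun setT f -> measurable_fun setT (fun x => (1 + cos (f x))%:E).
Proof.
move=> mf; apply/measurable_EFinP; apply: measurable_funD => //.
apply: measurableT_comp => //.
by apply: continuous_measurable_fun; exact: continuous_cos.
Qed.

Lemma onePcos_ge0 (x : R) : (0 <= (1 + cos x)%:E)%E.
Proof. by rewrite lee_fin -lerBlDl sub0r cos_geN1. Qed.

(** Rotating [z] onto the first axis leaves a one-dimensional Gaussian integral. Dimension [0] is
    apart because alignment requires a first axis. *)
Lemma integral_gaussN_1Dcos m (z : V m) (r th : R) :
  (\int[gaussN m]_g (1 + cos (r * dot z g + th))%:E =
   (1 + gcos (r * Num.sqrt (dot z z)) * cos th)%:E)%E.
Proof.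
have mk k (w : V k) : measurable_fun setT (fun g : V k => (1 + cos (r * dot w g + th))%:E).
  apply: measurable_1Dcos; apply: measurable_funD => //.
  by apply: measurable_funM => //; exact: measurable_dot.
case: m z => [|m] z.
  rewrite integral_prod_prob0; first by rewrite !dot0 sqrtr0 !mulr0 add0r gcos0 mul1r.
have [Q [Q' [[mQ tQ nQ nQ' iQ] [s E]]]] := gauss_align z.
rewrite -(iQ _ (mk _ z) (fun g => onePcos_ge0 _)).
under eq_integral do rewrite tQ.
have d0 (y : V m) : dot (vec_of m (fun=> 0)) y = 0.
  by rewrite /dot big1// => i _; rewrite entry_vec_of// mul0r.
rewrite -nQ' E dotS/= d0 addr0 -expr2 sqrtr_sqr.
rewrite (integral_gaussNS (mk _ ((s, vec_of m (fun=> 0)) : V m.+1)) (fun g => onePcos_ge0 _)).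
under eq_integral => x _.
  under eq_integral do rewrite dotS/= d0 addr0.
  rewrite (integral_prob_cst (gaussN m)) mulrA; over.
by rewrite integral_gauss_1Dcos -gcos_norm normrM -[in RHS]gcos_norm normrM normr_id.
Qed.

(** The planar integral of [1 + cos <z, g>] is evaluated by rotation and by iteration. This
    functional equation stands in for the closed form [exp (- t^2 / 2)]: sign, monotonicity and
    doubling of [gcos] are derived from it. *)
Lemma gcos_hypot x y : gcos (Num.sqrt (x ^+ 2 + y ^+ 2)) = gcos x * gcos y.
Proof.
pose z : V 2 := (x, (y, tt)).
have := integral_gaussN_1Dcos z 1 0.
rewrite mul1r cos0 mulr1 !dotS/= dot0 addr0 -!expr2.
have mz : measurable_fun setT (fun g : V 2 => (1 + cos (1 * dot z g + 0))%:E).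
  apply: measurable_1Dcos; apply: measurable_funD => //.
  by apply: measurable_funM => //; exact: measurable_dot.
rewrite (integral_gaussNS mz (fun g => onePcos_ge0 _)).
under eq_integral => a _.
  rewrite (integral_gaussNS (measurable_vec_section a mz) (fun g => onePcos_ge0 _)).
  under eq_integral => b _.
    under eq_integral do rewrite !dotS/= dot0 mul1r !addr0 [x * a + _]addrC.
    rewrite (integral_prob_cst (gaussN 0)); over.
  rewrite integral_gauss_1Dcos; over.
have mid : measurable_fun [set: R] (@id R) by exact: measurable_id.
have E : (\int[@gauss R]_a (1 + gcos y * cos (x * a))%:E =
    (1 + gcos y * gcos x)%:E)%E.
  rewrite -[in RHS](addr0 (gcos y * _)) -(mul0r (char_sin (@gauss R) id x)).
  rewrite -integral_trig//.
  by apply: eq_integral => a _; rewrite mul0r addr0.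
by rewrite E => -[] /addrI <-; rewrite mulrC.
Qed.

Lemma gcos_ge0 t : 0 <= gcos t.
Proof.
have := gcos_hypot (t / Num.sqrt 2) (t / Num.sqrt 2).
rewrite !expr_div_n sqr_sqrtr// -splitr sqrtr_sqr gcos_norm => ->.
by rewrite -expr2 sqr_ge0.
Qed.

Lemma gcos_le1 t : gcos t <= 1.
Proof. by apply: char_cos_le1; exact: measurable_id. Qed.

Lemma measurable_gcos : measurable_fun [set: R] gcos.
Proof. by apply: measurable_char_cos; exact: measurable_id. Qed.

Lemma gcos_nonincreasing x y : 0 <= x -> x <= y -> gcos y <= gcos x.
Proof.
move=> x0 xy; have y0 : 0 <= y by exact: le_trans xy.
have h : 0 <= y ^+ 2 - x ^+ 2 by rewrite subr_ge0 ler_pXn2r.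
have := gcos_hypot x (Num.sqrt (y ^+ 2 - x ^+ 2)).
rewrite sqr_sqrtr// addrC subrK sqrtr_sqr ger0_norm// => ->.
by rewrite ler_piMr ?gcos_ge0// gcos_le1.
Qed.

Lemma gcos_double x : gcos (2 * x) = gcos x ^+ 4.
Proof.
have E t : gcos (Num.sqrt 2 * t) = gcos t ^+ 2.
  rewrite [RHS]expr2 -gcos_hypot (_ : t ^+ 2 + t ^+ 2 = 2 * t ^+ 2); last by ring.
  rewrite sqrtrM// sqrtr_sqr.
  by rewrite -[LHS]gcos_norm -[RHS]gcos_norm !normrM normr_id.
have -> : 2 * x = Num.sqrt 2 * (Num.sqrt 2 * x) by rewrite mulrA -expr2 sqr_sqrtr.
by rewrite !E -exprM.
Qed.

Lemma gcos_pow2 x n : gcos (2 ^+ n * x) = gcos x ^+ (4 ^ n).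
Proof.
elim: n => [|n IH]; first by rewrite expr0 mul1r expr1.
by rewrite exprS -mulrA gcos_double IH -exprM expnSr.
Qed.

End gauss_char.

Section gauss_char_bounds.
Context {R : realType}.
Local Notation mu := (@lebesgue_measure R).

Lemma pow2_bracket (y : R) : 1 <= y -> exists n, 2 ^+ n <= y < 2 ^+ n.+1.
Proof.
move=> y1; have y0 : 0 <= y by exact: le_trans y1.
have /andP[h1 h2] := truncn_itv y0.
have t0 : (0 < Num.truncn y)%N.
  rewrite lt0n; apply/eqP => t0; move: h2; rewrite t0 => h2.
  by have := lt_le_trans h2 y1; rewrite ltxx.
have /andP[k1 k2] := @trunc_log_bounds 2 _ isT t0.
exists (trunc_log 2 (Num.truncn y)); apply/andP; split.
  by apply: le_trans h1; rewrite -natrX ler_nat.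
by apply: lt_le_trans h2 _; rewrite -natrX ler_nat.
Qed.

(** On [[1, 2]], which lies in [[0, pi]], both [1 - cos x >= 1 - cos 1] and
    [gauss_pdf x >= gauss_pdf 2] hold, so the mean of [1 - cos] is positive. *)
Lemma gcos1_lt1 : gcos 1 < 1 :> R.
Proof.
have mid : measurable_fun [set: R] (@id R) by exact: measurable_id.
pose h (x : R) := (1 - cos x)%:E.
have hE : (\int[@gauss R]_x h x = (1 - gcos 1)%:E)%E.
  rewrite -[(- gcos 1)]mulN1r -[in RHS](addr0 (-1 * _)).
  rewrite -(mul0r (char_sin (@gauss R) id 1)) -integral_trig//.
  by apply: eq_integral => x _; rewrite /h mul0r addr0 mul1r mulN1r.
have mh : measurable_fun [set: R] h.
  apply/measurable_EFinP; apply: measurable_funB => //.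
  by apply: continuous_measurable_fun; exact: continuous_cos.
have h0 x : (0 <= h x)%E by rewrite lee_fin subr_ge0 cos_le1.
pose k (x : R) := (h x * (gauss_pdf x)%:E)%E.
have mk : measurable_fun [set: R] k.
  apply: emeasurable_funM => //; apply/measurable_EFinP.
  exact: measurable_gauss_pdf.
have k0 x : (0 <= k x)%E by rewrite mule_ge0// lee_fin gauss_pdf_ge0.
have pi1 : (1 : R) \in `[0, pi].
  by rewrite in_itv/= ler01/= (le_trans _ (@pi_ge2 R))// ler1n.
have pi0 : (0 : R) \in `[0, pi] by rewrite in_itv/= lexx pi_ge0.
have cos1 : cos 1 < 1 :> R by rewrite -[ltRHS]cos0 ltr_cos// ltr01.
pose e := (1 - cos 1) * gauss_pdf (2 : R).
have e0 : 0 < e.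
  rewrite mulr_gt0 ?subr_gt0// gauss_pdfE mulr_gt0 ?expR_gt0//.
  by rewrite normal_peak_gt0// oner_eq0.
have : (e%:E <= (1 - gcos 1)%:E)%E.
  rewrite -hE integral_gauss//.
  have I12 : (\int[mu]_(x in `[1%R, 2%R]) e%:E = e%:E)%E.
    rewrite integral_cst//= lebesgue_measure_itv/= lte_fin ltr1n/=.
    by rewrite -EFinB (_ : 2 - 1 = 1 :> R) ?mule1//; ring.
  rewrite -I12; apply: (@le_trans _ _ (\int[mu]_(x in `[1%R, 2%R]) k x)%E); last first.
    by apply: ge0_subset_integral.
  apply: ge0_le_integral => //.
  - by move=> x _; rewrite lee_fin ltW.
  - exact: measurable_funTS.
  - move=> x /=; rewrite in_itv/= => /andP[x1 x2].
    rewrite /k /h -EFinM lee_fin /e.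
    have x0 : 0 <= x by apply: le_trans x1.
    apply: ler_pM.
    + by rewrite subr_ge0 ltW.
    + exact: gauss_pdf_ge0.
    + rewrite lerD2l lerN2; move: x1; rewrite le_eqVlt => /predU1P[<-//|x1].
      by rewrite ltW// ltr_cos// in_itv/= x0 (le_trans x2)// pi_ge2.
    + rewrite !gauss_pdfE ler_wpM2l ?normal_peak_ge0// ler_expR.
      rewrite !mulNr lerN2 ler_pM2r ?invr_gt0// ler_pXn2r ?nnegrE//.
rewrite lee_fin lerBrDl -lerBrDr => /le_lt_trans; apply.
by rewrite ltrBlDr ltrDl.
Qed.

(** For [2^n <= |y| < 2^(n+1)], monotonicity and doubling give [gcos y <= gcos 1 ^ (4^n)]. The
    division by [4] in the rate pays for replacing [2^n] by [y], and [expR kappa] covers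
    [|y| <= 1]. *)
Lemma gcos_decay : exists kappa : R, 0 < kappa /\
  forall y : R, gcos y <= expR kappa * expR (- (kappa * y ^+ 2)).
Proof.
pose k : R := (1 - gcos 1) / 4.
have k0 : 0 < k by rewrite divr_gt0// subr_gt0 gcos1_lt1.
exists k; split => // y; rewrite -gcos_norm -(real_normK (num_real y)).
have := normr_ge0 y; move: `|y| => {}y y0.
have [y1|y1] := leP y 1.
  apply: le_trans (gcos_le1 y) _.
  rewrite -expRD -[leLHS]expR0 ler_expR subr_ge0 ler_piMr ?(ltW k0)//.
  by rewrite expr_le1.
have [n /andP[n1 n2]] := pow2_bracket (ltW y1).
have g1 : gcos (1 : R) <= expR (- (4 * k)).
  rewrite mulrCA mulfV// mulr1 opprB.
  by apply: le_trans _ (expR_ge1Dx _); rewrite addrC subrK.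
apply: (@le_trans _ _ (gcos (2 ^+ n * 1))).
  by apply: gcos_nonincreasing; rewrite ?mulr1 ?exprn_ge0.
rewrite gcos_pow2; apply: (@le_trans _ _ (expR (- (4 * k)) ^+ (4 ^ n))).
  by rewrite lerXn2r ?nnegrE ?gcos_ge0 ?expR_ge0.
apply: (@le_trans _ _ (1 * expR (- (k * y ^+ 2)))); last first.
  by rewrite ler_pM2r ?expR_gt0// -[leLHS]expR0 ler_expR ltW.
rewrite mul1r -expRM_natl ler_expR mulrN lerN2.
rewrite (_ : _ * (4 * k) = k * (2 ^+ n.+1) ^+ 2); last first.
  rewrite natrX exprAC exprS (_ : 2 ^+ 2 = 4 :> R); last by ring.
  by rewrite mulrA mulrC -exprSr -exprS.
by rewrite ler_wpM2l ?(ltW k0)// ler_pXn2r ?nnegrE ?exprn_ge0// ltW.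
Qed.

Lemma gcos_integrable : exists C : R, 0 < C /\
  forall a b : R, a != 0 ->
    (\int[mu]_x (gcos (a * x + b))%:E <= (C / `|a|)%:E)%E.
Proof.
have [k [k0 hk]] := gcos_decay.
have mg : measurable_fun [set: R] (fun x => (@gcos R x)%:E).
  by apply/measurable_EFinP; exact: measurable_gcos.
have g0 x : (0 <= (@gcos R x)%:E)%E by rewrite lee_fin gcos_ge0.
pose s := Num.sqrt k; have s0 : 0 < s by rewrite sqrtr_gt0.
have s2 : s ^+ 2 = k by rewrite sqr_sqrtr// ltW.
pose C := expR k * (s^-1 * Num.sqrt pi).
have C0 : 0 < C by rewrite !mulr_gt0 ?expR_gt0 ?invr_gt0 ?sqrtr_gt0 ?pi_gt0.
exists C; split => // a b a0.
rewrite (integral_lebesgue_affine b a0 mg g0) mulrC EFinM.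
rewrite lee_pmul2l ?lte_fin ?invr_gt0 ?normr_gt0//.
have mgf : measurable_fun [set: R] (fun x => (@gauss_fun R x)%:E).
  by apply/measurable_EFinP; exact: measurable_gauss_fun.
have gf0 (x : R) : (0 <= (gauss_fun x)%:E)%E by rewrite lee_fin gauss_fun_ge0.
have mgs : measurable_fun [set: R] (fun x => (@gauss_fun R (s * x + 0))%:E).
  apply: (measurableT_comp mgf).
  by apply: measurable_funD => //; exact: measurable_funM.
apply: (@le_trans _ _ (\int[mu]_x ((expR k)%:E * (gauss_fun (s * x + 0))%:E))%E).
  apply: ge0_le_integral => //; first exact: measurable_funeM.
  move=> x _; rewrite -EFinM lee_fin /gauss_fun addr0 exprMn s2.
  exact: hk.
rewrite ge0_integralZl ?lee_fin ?expR_ge0//.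
rewrite (integral_lebesgue_affine 0 (lt0r_neq0 s0) mgf gf0) integralT_gauss.
by rewrite /C (gtr0_norm s0) !EFinM.
Qed.

(** Dominated convergence along [t = 1 / (n + 1)] produces one good point, and monotonicity fills in
    all smaller [|t|]. *)
Lemma gcos_near0 : exists r : R, 0 < r /\ forall t, `|t| <= r -> 1 / 2 <= gcos t.
Proof.
pose f_ (n : nat) (x : R) := (cos (n.+1%:R^-1 * x))%:E.
have mf n : measurable_fun [set: R] (f_ n).
  apply/measurable_EFinP; apply: measurableT_comp; last exact: measurable_funM.
  by apply: continuous_measurable_fun; exact: continuous_cos.
have cvg1 (x : R) : (fun n => f_ n x) @ \oo --> 1%E.
  apply: cvg_EFin; first exact: nearW.
  rewrite -[X in _ --> X](@cos0 R); apply: continuous_cvg.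
    exact: continuous_cos.
  rewrite -[X in _ --> X](mul0r x); apply: cvgMl.
  exact: cvg_harmonic.
have i1 : (@gauss R).-integrable setT (EFin \o (fun=> 1 : R)).
  by apply: (@prob_integrable _ _ _ (@gauss R) _ 1) => // x; rewrite normr1.
have f_le1 x n : (`|f_ n x| <= 1)%E by rewrite /f_ /= lee_fin cos_max.
have [_ _] := @dominated_convergence _ _ _ (@gauss R) setT measurableT f_
  (fun=> 1%E) (EFin \o (fun=> 1)) mf (measurable_cst _)
  (aeW _ (fun x _ => cvg1 x)) i1 (aeW _ (fun x n _ => f_le1 x n)).
rewrite (integral_prob_cst (@gauss R)) => /fine_cvgP[_].
move=> /(@cvgr_gt _ _ _ _ _ 1)/(_ (1 / 2)) => /(_ _)[|N _ hN].
  by rewrite ltr_pdivrMr// mul1r ltr1n.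
exists (N.+1%:R^-1); split; first by rewrite invr_gt0.
move=> t ht; rewrite -gcos_norm.
have := hN N (leqnn N) => /ltW/le_trans; apply.
by apply: gcos_nonincreasing.
Qed.

End gauss_char_bounds.

(** * One-dimensional estimates for laws of bounded density *)

Section power_of_doubling_sequence.
Context {R : realType}.

(** Combines [x^a <= exp (- a (1 - x))] with [y exp (- y) <= 1]. *)
Lemma powR_le_inv (x a : R) : 0 <= x -> x <= 1 -> 0 < a ->
  x `^ a * (a * (1 - x)) <= 1.
Proof.
move=> x0 x1 a0; have [->|xn0] := eqVneq x 0.
  by rewrite powR0 ?mul0r// gt_eqF.
have xp : 0 < x by rewrite lt_neqAle eq_sym xn0.
have y0 : 0 <= a * (1 - x) by rewrite mulr_ge0 ?subr_ge0// ltW.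
have h : x `^ a <= expR (- (a * (1 - x))).
  rewrite /powR (negbTE xn0) ler_expR -mulrN opprB ler_wpM2l ?(ltW a0)//.
  have h1 : -1 < x - 1 by rewrite ltrBrDr addNr.
  by have := le_ln1Dx h1; rewrite addrC subrK.
apply: (@le_trans _ _ (expR (- (a * (1 - x))) * (a * (1 - x)))).
  by rewrite ler_wpM2r.
rewrite expRN ler_pdivrMl ?expR_gt0// mulr1.
by apply: le_trans _ (expR_ge1Dx _); rewrite lerDr.
Qed.

(* The hypothesis is what [cos (2 t)] versus [cos t] gives for squared moduli of
   characteristic functions; at the scale where [4 ^ i * (1 - x 0)] crosses [1/2],
   [x i] is bounded below. *)
Lemma powR_le_doubling_sum (x : nat -> R) (a : R) : 1 <= a ->
  (forall i, 0 <= x i <= 1) -> (forall i, 1 - x i.+1 <= 4 * (1 - x i)) ->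
  forall N, x 0%N `^ a <= \sum_(i < N) 16 * 4 ^+ i / a * x i + 2 * x N.
Proof.
move=> a1 x01 dbl N; have a0 : 0 < a by exact: lt_le_trans a1.
have x_ge0 i : 0 <= x i by have /andP[] := x01 i.
have x_le1 i : x i <= 1 by have /andP[] := x01 i.
set psi := 1 - x 0%N.
have psi0 : 0 <= psi by rewrite subr_ge0.
have dblN n : 1 - x n <= 4 ^+ n * psi.
  elim: n => [|n IH]; first by rewrite mul1r.
  by apply: le_trans (dbl n) _; rewrite exprS -mulrA ler_wpM2l.
have xa_le1 : x 0%N `^ a <= 1.
  have := ge0_ler_powR (ltW a0) _ _ (x_le1 0%N).
  by rewrite powR1; apply; rewrite nnegrE.
(* [powR_le_inv] gives [1 / (a psi)], and here [1 / psi < 2 * 4^(n+1)]. *)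
have xa_le n : 1 / 2 < 4 ^+ n.+1 * psi -> x 0%N `^ a <= 8 * 4 ^+ n / a.
  move=> h; have := powR_le_inv (x_ge0 0%N) (x_le1 0%N) a0; rewrite -/psi => h2.
  rewrite ler_pdivlMr//.
  have p0 : 0 <= x 0%N `^ a by exact: powR_ge0.
  have : x 0%N `^ a * a * (1 / 2) <= x 0%N `^ a * a * (4 ^+ n.+1 * psi).
    by rewrite ler_wpM2l ?mulr_ge0// ltW.
  have : 4 ^+ n.+1 * (x 0%N `^ a * (a * psi)) <= 4 ^+ n.+1 * 1.
    by rewrite ler_wpM2l// exprn_ge0.
  rewrite exprS; lra.
(* Either the threshold is not crossed yet, or it was crossed at some [i]. A crossing just after a
   subcritical index forces [x i >= 1/2], which turns the [8] of [xa_le] into [16]. *)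
have key n : 4 ^+ n.+1 * psi <= 1 / 2 \/
    exists2 i, (i < n.+1)%N & x 0%N `^ a <= 16 * 4 ^+ i / a * x i.
  elim: n => [|n [h|[i ni h]]].
  - have [h|h] := leP (4 ^+ 1 * psi) (1 / 2); first by left.
    right; exists 0%N => //; have [h2|h2] := leP psi (1 / 2).
      apply: le_trans (xa_le 0%N h) _; rewrite expr0 !mulr1.
      have : 1 / 2 <= x 0%N by rewrite /psi in h2; lra.
      by move=> h3; rewrite mulrAC ler_pM2r ?invr_gt0//; lra.
    (* Beyond the threshold from the start, [x 0] has no lower bound; one factor [x 0] is split off,
       and the remaining power is at most [3 / a]. *)
    have x2 : x 0%N < 1 / 2 by rewrite /psi in h2; lra.
    have [->|xn0] := eqVneq (x 0%N) 0; first by rewrite powR0 ?mulr0// gt_eqF.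
    have -> : x 0%N `^ a = x 0%N * x 0%N `^ (a - 1).
      by rewrite -{2}(powRr1 (x_ge0 0%N)) -powRD ?xn0 ?implybT// addrC subrK.
    rewrite mulrC ler_wpM2r// expr0 mulr1.
    set y := _ `^ (a - 1).
    have y0 : 0 <= y by exact: powR_ge0.
    have y1 : y <= 1.
      have a10 : 0 <= a - 1 by rewrite subr_ge0.
      have := ge0_ler_powR a10 _ _ (x_le1 0%N).
      by rewrite powR1; apply; rewrite nnegrE.
    have hy : y * ((a - 1) * psi) <= 1.
      have [->|an1] := eqVneq a 1; first by rewrite subrr mul0r mulr0.
      by apply: powR_le_inv => //; rewrite subr_gt0 lt_neqAle eq_sym an1.
    rewrite ler_pdivlMr//.
    have : y * (a - 1) * (1 / 2) <= y * (a - 1) * psi.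
      by rewrite ler_wpM2l ?mulr_ge0 ?subr_ge0// ltW.
    nra.
  - have [h'|h'] := leP (4 ^+ n.+2 * psi) (1 / 2); first by left.
    right; exists n.+1 => //; apply: le_trans (xa_le n.+1 h') _.
    have xn : 1 / 2 <= x n.+1 by have := dblN n.+1; lra.
    rewrite [leRHS]mulrAC ler_pM2r ?invr_gt0//.
    have : 0 <= (4 : R) ^+ n.+1 by rewrite exprn_ge0.
    nra.
  - by right; exists i => //; rewrite ltnS ltnW.
have sum_ge0 n : 0 <= \sum_(i < n) 16 * 4 ^+ i / a * x i.
  by apply: sumr_ge0 => i _; rewrite !mulr_ge0 ?invr_ge0 ?exprn_ge0// ltW.
case: N => [|N].
  rewrite big_ord0 add0r; apply: (@le_trans _ _ (x 0%N)).
    rewrite -{2}(powRr1 (x_ge0 0%N)).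
    have [->|xn0] := eqVneq (x 0%N) 0; first by rewrite !powR0 ?oner_eq0 ?gt_eqF.
    by apply: ger_powR => //; rewrite lt_neqAle eq_sym xn0 x_ge0 x_le1.
  by rewrite ler_peMl// ler1n.
(* Without a crossing, [x N.+1 >= 1/2] and the last term alone is at least [1]. *)
have [h|[i ni h]] := key N.
  have xn : 1 / 2 <= x N.+1 by have := dblN N.+1; lra.
  by apply: le_trans xa_le1 _; have := sum_ge0 N.+1; lra.
apply: le_trans h _.
rewrite (bigD1 (Ordinal ni))//= -addrA lerDl addr_ge0 ?mulr_ge0//.
by apply: sumr_ge0 => j _; rewrite !mulr_ge0 ?invr_ge0 ?exprn_ge0// ltW.
Qed.

End power_of_doubling_sequence.

Section char_sqr_bounds.
Context {R : realType}.
Local Notation lam := (@lebesgue_measure R).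

(* Equivalent to [mu] having a density bounded by [K]. *)
Definition law_le (mu : probability R R) (K : R) :=
  forall h : R -> \bar R, measurable_fun [set: R] h -> (forall x, 0 <= h x)%E ->
    (\int[mu]_x h x <= K%:E * \int[lam]_x h x)%E.

Let mid : measurable_fun [set: R] (@id R). Proof. exact: measurable_id. Qed.

Let msub : measurable_fun setT (fun z : R * R => z.1 - z.2).
Proof. exact: measurable_funB. Qed.

(** Symmetrization: the difference of two independent copies has the squared modulus as its
    characteristic function, so it becomes a mean of cosines. *)
Lemma char_sqrE (mu : probability R R) t :
  char_sqr mu id t = char_cos (mu \x mu)%E (fun z : R * R => z.1 - z.2) t.
Proof.
have := integral_1Dcos (mu \x mu)%E msub t 0.
rewrite cos0 sin0 mulr1 mulr0 subr0.
pose k (z : R * R) := (1 + cos (t * (z.1 - z.2) + 0))%:E.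
have mk : measurable_fun setT k.
  apply: measurable_1Dcos; apply: measurable_funD => //.
  exact: measurable_funM.
have k0 z : (0 <= k z)%E by exact: onePcos_ge0.
rewrite (fubini_tonelli1 (m1 := mu) (m2 := mu) k mk k0) /fubini_F.
have E : (\int[mu]_x \int[mu]_y k (x, y) = (1 + char_sqr mu id t)%:E)%E.
  transitivity (\int[mu]_x (1 + (char_cos mu id t * cos (t * x) +
      char_sin mu id t * sin (t * x)))%:E)%E.
    apply: eq_integral => x _.
    rewrite [char_cos _ _ _ * _]mulrC [char_sin _ _ _ * _]mulrC -integral_trig//.
    by apply: eq_integral => y _; rewrite /k/= addr0 mulrBr cosB.
  by rewrite integral_trig// -!expr2.
by rewrite E => -[] /addrI.
Qed.

Lemma measurable_char_sqr (mu : probability R R) :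
  measurable_fun [set: R] (char_sqr mu id).
Proof.
have -> : char_sqr mu id = char_cos (mu \x mu)%E (fun z : R * R => z.1 - z.2).
  by apply/funext => t; exact: char_sqrE.
exact: measurable_char_cos.
Qed.

(** Pointwise, [1 - cos (2 u) = 2 (1 - cos u) (1 + cos u) <= 4 (1 - cos u)]. *)
Lemma char_cos_double d (T : measurableType d) (P : probability T R) (Y : T -> R) t :
  measurable_fun setT Y -> 1 - char_cos P Y (2 * t) <= 4 * (1 - char_cos P Y t).
Proof.
move=> mY.
have mc s : measurable_fun setT (fun x => cos (s * Y x)).
  apply: measurableT_comp; last exact: measurable_funM.
  by apply: continuous_measurable_fun; exact: continuous_cos.
have E r s : (\int[P]_x (r * (1 - cos (s * Y x)))%:E = (r * (1 - char_cos P Y s))%:E)%E.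
  transitivity (\int[P]_x (r + (- r * cos (s * Y x) + 0 * sin (s * Y x)))%:E)%E.
    by apply: eq_integral => x _; congr EFin; ring.
  by rewrite integral_trig//; congr EFin; ring.
rewrite -[leLHS]mul1r -lee_fin -!E; apply: ge0_le_integral => //.
- by apply/measurable_EFinP; apply: measurable_funM => //; exact: measurable_funB.
- by apply/measurable_EFinP; apply: measurable_funM => //; exact: measurable_funB.
- move=> x _; rewrite lee_fin mul1r -mulrA mulr_natl cos_mulr2n.
  have := cos_le1 (t * Y x); have := cos_geN1 (t * Y x).
  by move: (cos (t * Y x)) => c; nra.
Qed.

Lemma char_sqr_double (mu : probability R R) t :
  1 - char_sqr mu id (2 * t) <= 4 * (1 - char_sqr mu id t).
Proof. by rewrite !char_sqrE char_cos_double. Qed.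

Variables (C0 : R).
Hypothesis C0_gt0 : 0 < C0.
Hypothesis gcos_int : forall a b : R, a != 0 ->
  (\int[lam]_x (gcos (a * x + b))%:E <= (C0 / `|a|)%:E)%E.

Variables (mu : probability R R) (K : R).
Hypothesis K0 : 0 <= K.
Hypothesis mu_le : law_le mu K.

Lemma law_le_gcos a b : a != 0 ->
  (\int[mu]_x (gcos (a * x + b))%:E <= (K * C0 / `|a|)%:E)%E.
Proof.
move=> a0; apply: le_trans (mu_le _ _) _.
- apply/measurable_EFinP; apply: (measurableT_comp measurable_gcos).
  by apply: measurable_funD => //; exact: measurable_funM.
- by move=> x; rewrite lee_fin gcos_ge0.
by rewrite -mulrA EFinM; apply: lee_wpmul2l; rewrite ?lee_fin//; exact: gcos_int.
Qed.

(* The squared modulus is the mean of [cos (t (x - y))] over independent [x], [y]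
   of law [mu]; integrating over [t = s g + v] first leaves [gcos (s (x - y))]. *)
Lemma gauss_char_sqr_le (s v : R) : s != 0 ->
  (\int[@gauss R]_g (char_sqr mu id (s * g + v))%:E <= (K * C0 / `|s|)%:E)%E.
Proof.
move=> s0; set M := (mu \x mu)%E : probability (R * R)%type R.
set Y := fun z : R * R => z.1 - z.2.
have mx : measurable_fun [set: R] (fun g => char_sqr mu id (s * g + v)).
  apply: (measurableT_comp (measurable_char_sqr mu)).
  by apply: measurable_funD => //; exact: measurable_funM.
pose k (w : R * (R * R)) := (1 + cos ((s * w.1 + v) * Y w.2))%:E.
have mk : measurable_fun setT k.
  apply: measurable_1Dcos; apply: measurable_funM.
    by apply: measurable_funD => //; exact: measurable_funM.
  by apply: (measurableT_comp msub).
have k0 w : (0 <= k w)%E by exact: onePcos_ge0.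
have E1 : (\int[@gauss R]_g (1 + char_sqr mu id (s * g + v))%:E =
    \int[M]_z \int[@gauss R]_g (1 + cos ((s * g + v) * Y z))%:E)%E.
  rewrite -(fubini_tonelli (m1 := @gauss R) (m2 := M) k mk k0).
  apply: eq_integral => g _; rewrite char_sqrE -/M -/Y.
  have := integral_1Dcos M msub (s * g + v) 0.
  rewrite cos0 sin0 mulr1 mulr0 subr0 => <-.
  by apply: eq_integral => z _; rewrite addr0.
have E2 : (\int[M]_z (1 + gcos (s * Y z))%:E <= (1 + K * C0 / `|s|)%:E)%E.
  pose l (z : R * R) := (gcos (s * Y z))%:E.
  have ml : measurable_fun setT l.
    apply/measurable_EFinP; apply: (measurableT_comp measurable_gcos).
    exact: measurable_funM.
  have l0 z : (0 <= l z)%E by rewrite lee_fin gcos_ge0.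
  rewrite (eq_integral (fun z => 1%:E + l z)%E); last by move=> z _; rewrite EFinD.
  rewrite ge0_integralD//.
  rewrite (integral_prob_cst M) EFinD leeD2lE//.
  rewrite (fubini_tonelli2 (m1 := mu) (m2 := mu) l ml l0) /fubini_G.
  apply: (@le_trans _ _ (\int[mu]_y (K * C0 / `|s|)%:E)%E).
    apply: ge0_le_integral => //.
    - by move=> y _; exact: integral_ge0.
    - exact: (measurable_fun_fubini_tonelli_G (m1 := mu) l ml l0).
    - move=> y _; have := law_le_gcos (- (s * y)) s0.
      apply: le_trans; rewrite le_eqVlt; apply/orP; left; apply/eqP.
      by apply: eq_integral => x _; rewrite /l /Y/= mulrBr.
  by rewrite (integral_prob_cst mu).
rewrite -(@leeD2lE _ 1%:E)// -(integral_prob_cst (@gauss R) 1%:E) -ge0_integralD//; last 2 first.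
- by move=> g _; rewrite lee_fin char_sqr_ge0.
- exact/measurable_EFinP.
rewrite (integral_prob_cst (@gauss R)) -EFinD.
under eq_integral do rewrite -EFinD.
rewrite E1; apply: le_trans _ E2; apply: ge0_le_integral => //.
- by move=> z _; apply: integral_ge0 => g _; exact: onePcos_ge0.
- exact: (measurable_fun_fubini_tonelli_G (m1 := @gauss R) k mk k0).
- apply/measurable_EFinP; apply: measurable_funD => //.
  by apply: (measurableT_comp measurable_gcos); exact: measurable_funM.
- move=> z _.
  rewrite (eq_integral (fun g => (1 + cos ((s * Y z) * g + v * Y z))%:E)); last first.
    by move=> g _; congr (1 + cos _)%:E; ring.
  (* The shift [v] survives only as a factor [cos (v * Y z) <= 1], harmless because [gcos] is
     nonnegative. *)
  by rewrite integral_gauss_1Dcos lee_fin lerD2l ler_piMr ?gcos_ge0 ?cos_le1.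
Qed.

(** The gain [1 / sqrt a] over [gauss_char_sqr_le] is what becomes [sqrt (p j)] in Brascamp-Lieb. At
    scale [2^i] the weight [16 * 4^i / a] meets an integral of order [2^-i]. Stopping when [2^N] is
    within a factor [2] of [sqrt a], the sum gives [16 / sqrt a] and the last term [4 / sqrt a],
    whence [20]. *)
Lemma gauss_char_sqr_powR_le (s v a : R) : 1 <= a ->
  (`|s|%:E * \int[@gauss R]_g (char_sqr mu id (s * g + v) `^ a)%:E <=
    (20 * (K * C0) / Num.sqrt a)%:E)%E.
Proof.
move=> a1; have a0 : 0 < a by exact: lt_le_trans a1.
have sa0 : 0 < Num.sqrt a by rewrite sqrtr_gt0.
have KC0 : 0 <= K * C0 by rewrite mulr_ge0// ltW.
have [->|s0] := eqVneq s 0.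
  by rewrite normr0 mul0e lee_fin mulr_ge0 ?invr_ge0 ?(ltW sa0)// mulr_ge0.
have sp : 0 < `|s| by rewrite normr_gt0.
have [N /andP[N1 N2]] : exists n, 2 ^+ n <= Num.sqrt a < 2 ^+ n.+1.
  by apply: pow2_bracket; rewrite -[leLHS]sqrtr1 ler_sqrt ?(ltW a0).
pose x i g : R := char_sqr mu id (2 ^+ i * (s * g + v)).
have x0 i g : 0 <= x i g by exact: char_sqr_ge0.
have x1 i g : x i g <= 1 by exact: char_sqr_le1.
have mx i : measurable_fun [set: R] (x i).
  apply: (measurableT_comp (measurable_char_sqr mu)); apply: measurable_funM => //.
  by apply: measurable_funD => //; exact: measurable_funM.
have intx i : (\int[@gauss R]_g (x i g)%:E <= (K * C0 / `|s| / 2 ^+ i)%:E)%E.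
  have si0 : 2 ^+ i * s != 0 by rewrite mulf_neq0// expf_neq0// pnatr_eq0.
  have := gauss_char_sqr_le (2 ^+ i * v) si0.
  rewrite normrM normrX ger0_norm// invfM mulrA [_ / 2 ^+ i / _]mulrAC.
  apply: le_trans; rewrite le_eqVlt; apply/orP; left; apply/eqP.
  by apply: eq_integral => g _; rewrite /x mulrDr mulrA.
pose w i : R := 16 * 4 ^+ i / a.
have w0 i : 0 <= w i by rewrite !mulr_ge0 ?invr_ge0 ?exprn_ge0// ltW.
have le_sum : (\int[@gauss R]_g (char_sqr mu id (s * g + v) `^ a)%:E <=
    \sum_(i < N) (w i)%:E * \int[@gauss R]_g (x i g)%:E +
    2%:E * \int[@gauss R]_g (x N g)%:E)%E.
  apply: (@le_trans _ _ (\int[@gauss R]_g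
      (\sum_(i < N) (w i)%:E * (x i g)%:E + 2%:E * (x N g)%:E))%E).
    apply: ge0_le_integral => //.
    - by move=> g _; rewrite lee_fin powR_ge0.
    - apply/measurable_EFinP; apply: (measurableT_comp (measurable_powR a)).
      have -> : (fun g => char_sqr mu id (s * g + v)) = x 0%N.
        by apply/funext => g; rewrite /x mul1r.
      exact: mx.
    - apply: emeasurable_funD; last by apply: measurable_funeM; exact/measurable_EFinP.
      by apply: emeasurable_sum => i; apply: measurable_funeM; exact/measurable_EFinP.
    - move=> g _.
      under eq_bigr do rewrite -EFinM.
      rewrite sumEFin -EFinM -EFinD lee_fin.
      have := @powR_le_doubling_sum R (x ^~ g) a a1.
      rewrite [x 0%N g](_ : _ = char_sqr mu id (s * g + v)); last by rewrite /x mul1r.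
      apply.
      + by move=> i; rewrite x0 x1.
      + by move=> i; rewrite /x exprS -mulrA char_sqr_double.
  have mxE i : measurable_fun [set: R] (fun g => (x i g)%:E).
    exact/measurable_EFinP.
  have xE0 i g : [set: R] g -> (0 <= (x i g)%:E)%E by rewrite lee_fin.
  have EZ i c : 0 <= c -> (\int[@gauss R]_g (c%:E * (x i g)%:E) =
      c%:E * \int[@gauss R]_g (x i g)%:E)%E.
    by move=> c0; apply: ge0_integralZl => //; exact: xE0.
  have mwx c i : measurable_fun [set: R] (fun g => c%:E * (x i g)%:E)%E.
    exact: measurable_funeM.
  have wx0 c i g : 0 <= c -> [set: R] g -> (0 <= c%:E * (x i g)%:E)%E.
    by move=> c0 _; rewrite -EFinM lee_fin mulr_ge0.
  rewrite ge0_integralD//.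
  - rewrite ge0_integral_sum//; last by move=> i g _; exact: wx0.
    by rewrite EZ//; under eq_bigr do rewrite EZ//.
  - by move=> g _; apply: sume_ge0 => i _; exact: wx0.
  - by apply: emeasurable_sum.
  - by move=> g _; exact: wx0.
have sum_pow2 n : \sum_(i < n) (2 : R) ^+ i <= 2 ^+ n.
  elim: n => [|n IH]; first by rewrite big_ord0 exprn_ge0.
  by rewrite big_ord_recr/= exprS; lra.
apply: (@le_trans _ _ (`|s|%:E * (\sum_(i < N) w i * (K * C0 / `|s| / 2 ^+ i) +
    2 * (K * C0 / `|s| / 2 ^+ N))%:E)%E).
  apply: lee_wpmul2l; first by rewrite lee_fin.
  apply: le_trans le_sum _; rewrite [leRHS]EFinD -sumEFin; apply: leeD.
    apply: lee_sum => i _; rewrite [leRHS]EFinM; apply: lee_wpmul2l => //.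
    by rewrite lee_fin.
  by rewrite [leRHS]EFinM; apply: lee_wpmul2l.
rewrite -EFinM lee_fin.
have -> : \sum_(i < N) w i * (K * C0 / `|s| / 2 ^+ i) =
    16 / a * (K * C0 / `|s|) * \sum_(i < N) 2 ^+ i.
  rewrite mulr_sumr; apply: eq_bigr => i _; rewrite /w.
  have -> : (4 : R) ^+ i = 2 ^+ i * 2 ^+ i.
    by rewrite -exprMn; congr (_ ^+ _); ring.
  by field; rewrite !gt_eqF// exprn_gt0.
have aE : a = Num.sqrt a ^+ 2 by rewrite sqr_sqrtr// ltW.
move: (Num.sqrt a) aE N1 N2 sa0 => t aE N1 N2 t0; rewrite aE.
have p0 : 0 < (2 : R) ^+ N by rewrite exprn_gt0.
rewrite [leLHS](_ : _ = K * C0 *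
  (16 / t ^+ 2 * (\sum_(i < N) 2 ^+ i) + 2 / 2 ^+ N)); last first.
  by field; rewrite !gt_eqF// exprn_gt0.
rewrite [20 * _]mulrC -[leRHS]mulrA ler_wpM2l//.
apply: (@le_trans _ _ (16 / t + 4 / t)); last by rewrite -mulrDl ler_pM2r ?invr_gt0//; lra.
apply: lerD.
  rewrite [leRHS](_ : _ = 16 / t ^+ 2 * t); last by field; rewrite gt_eqF.
  rewrite ler_wpM2l ?mulr_ge0 ?invr_ge0 ?exprn_ge0 ?(ltW t0)//.
  exact: le_trans (sum_pow2 N) N1.
rewrite ler_pdivrMr// mulrAC ler_pdivlMr// [leRHS]mulrC.
by move: N2; rewrite exprS; lra.
Qed.

End char_sqr_bounds.

(** * Mean of the Gaussian kernel under a product law *)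

Section independent_coordinates.
Context {R : realType}.
Local Notation V m := (@vec R m).

Fixpoint upd n (j : nat) (y : R) : V n -> V n :=
  match n return V n -> V n with
  | 0 => id
  | n'.+1 => fun x => if j is j'.+1 then (x.1, @upd n' j' y x.2) else (y, x.2)
  end.

Lemma entry_upd n j y (x : V n) k : (k < n)%N ->
  entry (upd j y x) k = if k == j then y else entry x k.
Proof. by elim: n j k x => [|n IH] [|j] [|k] x //= kn; rewrite IH. Qed.

Lemma measurable_upd n j :
  @measurable_fun _ _ (V n * R)%type (V n) setT (fun z => upd j z.2 z.1).
Proof.
elim: n j => [|n IH] j; first exact: measurable_fst.
have m1 : @measurable_fun _ _ (V n.+1 * R)%type (V n) setT (fun z => z.1.2).
  apply: (measurableT_comp (@measurable_snd _ _ R (V n))).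
  exact: (@measurable_fst _ _ (V n.+1) R).
case: j => [|j] /=.
  by apply: (@measurable_fun_pair _ _ _ _ R (V n)).
apply: (@measurable_fun_pair _ _ _ _ R (V n)).
  apply: (measurableT_comp (@measurable_fst _ _ R (V n))).
  exact: (@measurable_fst _ _ (V n.+1) R).
have mg : @measurable_fun _ _ (V n.+1 * R)%type (V n * R)%type setT
    (fun z => (z.1.2 : V n, z.2)).
  by apply: (@measurable_fun_pair _ _ _ _ (V n) R).
exact: (measurableT_comp (IH j) mg).
Qed.

Lemma measurable_resample n j (mu : probability R R) (h : V n -> \bar R) :
  measurable_fun setT h -> (forall x, 0 <= h x)%E ->
  measurable_fun setT (fun x => \int[mu]_y h (upd j y x))%E.
Proof.
move=> mh h0; pose k (z : V n * R) := h (upd j z.2 z.1).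
have mk : measurable_fun setT k by apply: (measurableT_comp mh); exact: measurable_upd.
exact: (measurable_fun_fubini_tonelli_F (m2 := mu) k mk (fun=> h0 _)).
Qed.

(** Redrawing one coordinate preserves the product law, so any coordinate can be integrated out
    first without permuting the factors. *)
Lemma integral_resample n (mu : nat -> probability R R) j (h : V n -> \bar R) :
  (j < n)%N -> measurable_fun setT h -> (forall x, 0 <= h x)%E ->
  (\int[prod_prob n mu]_x h x =
   \int[prod_prob n mu]_x \int[mu j]_y h (upd j y x))%E.
Proof.
elim: n mu j h => [|n IH] mu [|j] h// jn mh h0.
- rewrite (integral_prod_probS _ mh h0).
  rewrite (integral_prod_probS _ (measurable_resample 0 (mu 0%N) mh h0)); last first.
    by move=> x; exact: integral_ge0.
  under [RHS]eq_integral => x _.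
    rewrite /= -(fubini_tonelli (m1 := mu 0%N)
      (m2 := prod_prob n (fun k => mu k.+1)) h mh h0).
    over.
  by rewrite (integral_prob_cst (mu 0%N)).
- rewrite (integral_prod_probS _ mh h0).
  rewrite (integral_prod_probS _ (measurable_resample j.+1 (mu j.+1) mh h0)); last first.
    by move=> x; exact: integral_ge0.
  apply: eq_integral => x _.
  by rewrite (IH (fun k => mu k.+1) j)//; exact: measurable_vec_section.
Qed.

(** By [char_phase], averaging one coordinate multiplies the cosine by the modulus [r <= 1] and adds
    a phase, absorbed by the free [th]. Writing [1 + r cos] as [(1 - r) + r (1 + cos)] makes the
    induction hypothesis applicable. *)
Lemma integral_prod_prob_cos_le n (mu : nat -> probability R R) (t : nat -> R) th :
  (\int[prod_prob n mu]_x (1 + cos (\sum_(j < n) entry x j * t j + th))%:E <=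
   (1 + \prod_(j < n) Num.sqrt (char_sqr (mu j) id (t j)))%:E)%E.
Proof.
have mid : measurable_fun [set: R] (@id R) by exact: measurable_id.
have mS k (s : nat -> R) c :
    measurable_fun setT (fun x : V k => \sum_(j < k) entry x j * s j + c).
  apply: measurable_funD => //; apply: measurable_sum => j.
  by apply: measurable_funM => //; exact: measurable_entry.
elim: n mu t th => [|n IH] mu t th.
  by rewrite integral_prod_prob0 !big_ord0 lee_fin lerD2l cos_le1.
have [psi hpsi] := char_phase (mu 0%N) mid (t 0%N).
set r := Num.sqrt _ in hpsi.
have r0 : 0 <= r by exact: sqrtr_ge0.
have r1 : r <= 1 by rewrite -[leRHS]sqrtr1 ler_sqrt// char_sqr_le1.
pose nu := prod_prob n (fun k => mu k.+1).
pose L (y : V n) := \sum_(j < n) entry y j * t j.+1.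
pose k (z : R * V n) := (1 + cos (t 0%N * z.1 + (L z.2 + th)))%:E.
have mk : measurable_fun setT k.
  apply: measurable_1Dcos; apply: measurable_funD; first exact: measurable_funM.
  by apply: (measurableT_comp (mS n (fun j => t j.+1) th)).
have k0 z : (0 <= k z)%E by exact: onePcos_ge0.
rewrite (integral_prod_probS _ (measurable_1Dcos (mS n.+1 t th)) (fun=> onePcos_ge0 _)).
have -> : (\int[mu 0%N]_x \int[nu]_y
    (1 + cos (\sum_(j < n.+1) entry ((x, y) : V n.+1) j * t j + th))%:E =
    \int[mu 0%N]_x \int[nu]_y k (x, y))%E.
  apply: eq_integral => x _; apply: eq_integral => y _.
  by rewrite big_ord_recl/= mulrC -addrA.
rewrite (fubini_tonelli (m1 := mu 0%N) (m2 := nu) k mk k0).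
have mc : measurable_fun setT (fun y : V n => (1 + cos (L y + (th + psi)))%:E).
  exact: (measurable_1Dcos (mS n (fun j => t j.+1) (th + psi))).
have -> : (\int[nu]_y \int[mu 0%N]_x k (x, y) =
    \int[nu]_y ((1 - r)%:E + r%:E * (1 + cos (L y + (th + psi)))%:E))%E.
  apply: eq_integral => y _; rewrite /k/= hpsi -EFinM -EFinD -addrA.
  by congr EFin; ring.
rewrite ge0_integralD//; last 3 first.
- by move=> y _; rewrite lee_fin subr_ge0.
- by move=> y _; rewrite mule_ge0// ?lee_fin// onePcos_ge0.
- exact: measurable_funeM.
rewrite (integral_prob_cst nu) ge0_integralZl//.
apply: (@le_trans _ _ ((1 - r)%:E + r%:E *
    (1 + \prod_(j < n) Num.sqrt (char_sqr (mu j.+1) id (t j.+1)))%:E)%E).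
  rewrite leeD2l// lee_wpmul2l ?lee_fin//.
  exact: (IH (fun k => mu k.+1) (fun j => t j.+1)).
rewrite -EFinM -EFinD lee_fin big_ord_recl/= -/r le_eqVlt; apply/orP; left; apply/eqP.
by ring.
Qed.

End independent_coordinates.

Section gaussian_kernel.
Context {R : realType}.
Local Notation V m := (@vec R m).

Definition vcomb n m (a : nat -> V m) (u : V m) (x : V n) : V m :=
  vec_of m (fun i => \sum_(j < n) entry x j * entry (a j) i + entry u i).

Lemma dot_vcomb n m (a : nat -> V m) (u : V m) (x : V n) (g : V m) :
  dot (vcomb a u x) g = \sum_(j < n) entry x j * dot (a j) g + dot u g.
Proof.
rewrite /dot /vcomb.
under eq_bigr => i _ do rewrite entry_vec_of// mulrDl mulr_suml.
rewrite big_split/= exchange_big/=; congr (_ + _); apply: eq_bigr => j _.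
by rewrite mulr_sumr; apply: eq_bigr => i _; rewrite mulrA.
Qed.

Lemma vcombS n m (a : nat -> V m.+1) (u : V m.+1) (x : V n) :
  vcomb a u x = (\sum_(j < n) entry x j * (a j).1 + u.1,
                 vcomb (fun j => (a j).2 : V m) u.2 x).
Proof. by []. Qed.

Lemma measurable_sqrt_vcomb n m (a : nat -> V m) (u : V m) :
  measurable_fun setT (fun x : V n => Num.sqrt (dot (vcomb a u x) (vcomb a u x))).
Proof.
have mv i : measurable_fun setT (fun x : V n => entry (vcomb a u x) i).
  have [im|im] := ltnP i m.
    have -> : (fun x : V n => entry (vcomb a u x) i) =
        fun x => \sum_(j < n) entry x j * entry (a j) i + entry u i.
      by apply/funext => x; rewrite entry_vec_of.
    apply: measurable_funD => //; apply: measurable_sum => j.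
    by apply: measurable_funM => //; exact: measurable_entry.
  suff -> : (fun x : V n => entry (vcomb a u x) i) = cst 0 by exact: measurable_cst.
  apply/funext => x /=; move: (vcomb a u x); clear -im.
  by elim: m i im => [|m IH] [|i]//= im z; rewrite IH.
apply: measurableT_comp.
  by apply: continuous_measurable_fun; exact: sqrt_continuous.
by apply: measurable_sum => i; exact: measurable_funM.
Qed.

Definition kern n m (r : R) (a : nat -> V m) (u : V m) (x : V n) : R :=
  gcos (r * Num.sqrt (dot (vcomb a u x) (vcomb a u x))).

Lemma kern_ge0 n m r (a : nat -> V m) u (x : V n) : 0 <= kern r a u x.
Proof. exact: gcos_ge0. Qed.

Lemma kern_le1 n m r (a : nat -> V m) u (x : V n) : kern r a u x <= 1.
Proof. exact: gcos_le1. Qed.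

Lemma measurable_kern n m r (a : nat -> V m) u :
  measurable_fun setT (fun x : V n => kern r a u x).
Proof.
apply: (measurableT_comp measurable_gcos); apply: measurable_funM => //.
exact: measurable_sqrt_vcomb.
Qed.

Lemma integral_gaussN_kern n m r (a : nat -> V m) u (x : V n) :
  (\int[gaussN m]_g
     (1 + cos (\sum_(j < n) entry x j * (r * dot (a j) g) + r * dot u g))%:E =
   (1 + kern r a u x)%:E)%E.
Proof.
have := integral_gaussN_1Dcos (vcomb a u x) r 0.
rewrite cos0 mulr1 => <-; apply: eq_integral => g _.
rewrite dot_vcomb addr0 mulrDr [r * (\sum_(_ < _) _ * dot _ _)]mulr_sumr.
by congr (1 + cos (_ + _))%R%:E; apply: eq_bigr => j _; rewrite mulrCA.
Qed.

Lemma measurable_kern_integrand n m r (a : nat -> V m) u :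
  measurable_fun setT (fun z : V m * V n =>
    (1 + cos (\sum_(j < n) entry z.2 j * (r * dot (a j) z.1) + r * dot u z.1))%:E).
Proof.
have md (w : V m) : @measurable_fun _ _ (V m * V n)%type R setT (fun z => r * dot w z.1).
  apply: measurable_funM => //.
  by apply: (measurableT_comp (measurable_dot w)); exact: measurable_fst.
apply: measurable_1Dcos; apply: measurable_funD => //.
apply: measurable_sum => j; apply: measurable_funM => //.
apply: (measurableT_comp (@measurable_entry R n j)); exact: measurable_snd.
Qed.

(** Proved through the Gaussian mean: the adjoint identity carries [Q] from [g] to the columns as
    [Q'], and invariance of [gaussN] removes it. *)
Lemma kern_isometry n m r (a : nat -> V m) u (Q Q' : V m -> V m) (x : V n) :
  gauss_isometry Q Q' -> kern r a u x = kern r (fun j => Q' (a j)) (Q' u) x.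
Proof.
move=> [mQ tQ _ _ iQ].
have mk : measurable_fun setT (fun g : V m =>
    (1 + cos (\sum_(j < n) entry x j * (r * dot (a j) g) + r * dot u g))%:E).
  exact: (measurableT_comp (measurable_kern_integrand r a u)
    (@pair2_measurable _ _ (V m) (V n) x)).
have E := iQ _ mk (fun g => onePcos_ge0 _).
rewrite [RHS]integral_gaussN_kern in E.
suff : (1 + kern r (fun j => Q' (a j)) (Q' u) x)%:E = (1 + kern r a u x)%:E.
  by move=> -[] /addrI.
rewrite -E -integral_gaussN_kern; apply: eq_integral => g _; rewrite tQ.
by congr (1 + cos (_ + _))%R%:E; apply: eq_bigr => j _; rewrite tQ.
Qed.

(** [gcos_hypot] factors the kernel over orthogonal directions, so that integrating out one
    direction leaves a kernel of the same kind. *)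
Lemma kernS n m r (a : nat -> V m.+1) (u : V m.+1) (x : V n) :
  kern r a u x = gcos (r * (\sum_(j < n) entry x j * (a j).1 + u.1)) *
                 kern r (fun j => (a j).2 : V m) u.2 x.
Proof.
rewrite /kern vcombS dotS/=; set w := _ + u.1; set d := dot _ _.
have d0 : 0 <= d by exact: dot_ge0.
rewrite -gcos_hypot -[LHS]gcos_norm normrM (ger0_norm (sqrtr_ge0 _)) -sqrtr_sqr.
rewrite -sqrtrM ?sqr_ge0//; congr (gcos (Num.sqrt _)).
by rewrite exprMn exprMn sqr_sqrtr//; ring.
Qed.

End gaussian_kernel.

Section kernel_estimate.
Context {R : realType}.
Local Notation V m := (@vec R m).
Local Notation lam := (@lebesgue_measure R).
Variables (C0 : R).
Hypothesis C0_gt0 : 0 < C0.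
Hypothesis gcos_int : forall a b : R, a != 0 ->
  (\int[lam]_x (gcos (a * x + b))%:E <= (C0 / `|a|)%:E)%E.

(* [b j] is kept strictly above [p j = |a j|^2] so that it stays positive when
   [a j = 0]. *)
Lemma integral_kern_le_prod n m (mu : nat -> probability R R) (K r : R)
    (a : nat -> V m) (u : V m) (b : nat -> R) :
  0 < K -> 0 < r -> (forall j, law_le (mu j) K) ->
  (forall j, (j < n)%N -> dot (a j) (a j) <= 1 / 2) ->
  (forall y, \sum_(j < n) dot (a j) y ^+ 2 <= dot y y) ->
  (forall j, dot (a j) (a j) < b j) ->
  (\int[prod_prob n mu]_x (kern r a u x)%:E <=
   (\prod_(j < n) ((20 * Num.sqrt 2 * C0 * K / r) `^ dot (a j) (a j) *
                   expR (b j / 2)))%:E)%E.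
Proof.
move=> K0 r0 mu_le a_small frame ab.
set D := 20 * _ * C0 * K / r.
have D0 : 0 < D by rewrite !mulr_gt0 ?invr_gt0 ?sqrtr_gt0.
pose p j := dot (a j) (a j).
have p0 j : 0 <= p j by exact: dot_ge0.
(* Setting [F j] to [0] elsewhere is harmless: a factor with [p j = 0] is raised to the power [0]
   and equals [1], and [a_small] excludes [p j > 1/2] for the indices in the product. *)
pose small j := (0 < p j) && (p j <= 1 / 2).
pose F j t : R :=
  if small j then char_sqr (mu j) id (r * t) `^ (2 * p j)^-1 else 0.
have mF j : measurable_fun [set: R] (F j).
  rewrite /F; case: (small j) => //.
  apply: (measurableT_comp (measurable_powR _)).
  by apply: (measurableT_comp (measurable_char_sqr (mu j))); exact: measurable_funM.
have F0 j t : 0 <= F j t by rewrite /F; case: ifP => // _; exact: powR_ge0.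
have b0 j : 0 < b j := le_lt_trans (p0 j) (ab j).
have F_gauss j s v :
    (`|s|%:E * \int[@gauss R]_x (F j (s * x + v))%:E <= (D * Num.sqrt (b j))%:E)%E.
  rewrite /F; case sj : (small j); last first.
    by rewrite integral0 mule0 lee_fin mulr_ge0 ?sqrtr_ge0// ltW.
  have /andP[pj0 pj1] := sj.
  have a1 : 1 <= (2 * p j)^-1.
    by rewrite invf_ge1 ?mulr_gt0// mulrC -ler_pdivlMr// mul1r -div1r.
  have := gauss_char_sqr_powR_le C0_gt0 gcos_int (ltW K0) (mu_le j) (r * s) (r * v) a1.
  under eq_integral => x _ do rewrite -mulrA -mulrDr.
  rewrite normrM (gtr0_norm r0) EFinM -muleA -lee_pdivlMl// => h.
  apply: le_trans h _; rewrite -EFinM lee_fin.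
  rewrite sqrtrV ?mulr_ge0// invrK sqrtrM//.
  rewrite [leLHS](_ : _ = D * Num.sqrt (p j)); last by rewrite /D; field; rewrite gt_eqF.
  by rewrite ler_pM2l// ler_sqrt ltW// ab.
have BL := gauss_brascamp_lieb D0 mF F0 b0 F_gauss (fun=> 0) frame.
set B := \prod_(j < n) _ in BL *.
pose k (z : V m * V n) :=
  (1 + cos (\sum_(j < n) entry z.2 j * (r * dot (a j) z.1) + r * dot u z.1))%:E.
have mk : measurable_fun setT k by exact: measurable_kern_integrand.
have k0 z : (0 <= k z)%E by exact: onePcos_ge0.
have mkern : measurable_fun setT (fun x : V n => (kern r a u x)%:E).
  by apply/measurable_EFinP; exact: measurable_kern.
(* Adding [1] on both sides makes the cosine integrand nonnegative, ready for the exchange of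
   integrals. *)
have -> : (\int[prod_prob n mu]_x (kern r a u x)%:E <= B%:E)%E =
    (\int[prod_prob n mu]_x (1 + kern r a u x)%:E <= (1 + B)%:E)%E.
  under [in RHS]eq_integral do rewrite EFinD.
  rewrite ge0_integralD//; last by move=> x _; rewrite lee_fin kern_ge0.
  by rewrite (integral_prob_cst (prod_prob n mu)) EFinD leeD2lE.
have -> : (\int[prod_prob n mu]_x (1 + kern r a u x)%:E =
    \int[gaussN m]_g \int[prod_prob n mu]_x k (g, x))%E.
  rewrite (fubini_tonelli (m1 := gaussN m) (m2 := prod_prob n mu) k mk k0).
  by apply: eq_integral => x _; rewrite integral_gaussN_kern.
pose G (g : V m) := \prod_(j < n) F j (dot (a j) g + 0) `^ p j.
have G0 g : 0 <= G g by apply: prodr_ge0 => j _; exact: powR_ge0.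
have mG : measurable_fun setT G.
  apply: measurable_prod => j _.
  apply: (measurableT_comp (measurable_powR _)).
  apply: (measurableT_comp (mF j)).
  by apply: measurable_funD => //; exact: measurable_dot.
apply: (@le_trans _ _ (\int[gaussN m]_g (1%:E + (G g)%:E))%E).
  apply: ge0_le_integral => //.
  - by move=> g _; exact: integral_ge0.
  - exact: (measurable_fun_fubini_tonelli_F (m2 := prod_prob n mu) k mk k0).
  - by apply: emeasurable_funD => //; exact/measurable_EFinP.
  - move=> g _.
    have H := integral_prod_prob_cos_le n mu (fun j => r * dot (a j) g) (r * dot u g).
    apply: le_trans H _; rewrite -EFinD lee_fin lerD2l; apply: ler_prod => j _.
    rewrite sqrtr_ge0/= addr0.
    have x1 : Num.sqrt (char_sqr (mu j) id (r * dot (a j) g)) <= 1.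
      by rewrite -[leRHS]sqrtr1 ler_sqrt// char_sqr_le1.
    have [pj|pj] := eqVneq (p j) 0; first by rewrite pj powRr0.
    have sj : small j by rewrite /small lt_neqAle eq_sym pj p0 a_small.
    rewrite /F sj -powRrM invfM divfK//.
    by rewrite powR12_sqrt// char_sqr_ge0.
rewrite ge0_integralD//; last 2 first.
- by move=> g _; rewrite lee_fin.
- exact/measurable_EFinP.
by rewrite (integral_prob_cst (gaussN m)) [leRHS]EFinD leeD2lE.
Qed.

Let prod_powR_expR n (p : nat -> R) (D c : R) : 0 < D ->
  \prod_(j < n) (D `^ p j * expR ((p j + c) / 2)) =
  expR ((\sum_(j < n) p j) * (ln D + 1 / 2) + n%:R * c / 2).
Proof.
move=> D0; elim: n => [|n IH]; first by rewrite !big_ord0 !mul0r addr0 expR0.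
rewrite !big_ord_recr/= IH /powR gt_eqF// -!expRD -natr1; congr expR.
by ring.
Qed.

Let entry_vec0 m l : entry (vec_of m (fun=> 0) : V m) l = 0.
Proof. by elim: m l => [|m IH] [|l]/=. Qed.

Let dot_vec0 m (y : V m) : dot (vec_of m (fun=> 0)) y = 0.
Proof. by rewrite /dot big1// => i _; rewrite entry_vec0 mul0r. Qed.

(** With [b j = p j + 1 / n] the product is [expR (s (ln D + 1/2) + 1/2)], where [s] is the sum of
    the [p j]. If [ln D + 1/2 <= 0], then [s] can be lowered to [k + 1], and [(k + 1) / 2] covers
    the spare [1/2], whence the factor [expR 1]. Otherwise the right side is at least [1]. *)
Lemma integral_kern_le_small n m (mu : nat -> probability R R) (K r : R)
    (a : nat -> V m) (u : V m) k :
  0 < K -> 0 < r -> (forall j, law_le (mu j) K) ->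
  (forall j, (j < n)%N -> dot (a j) (a j) <= 1 / 2) ->
  (forall y, \sum_(j < n) dot (a j) y ^+ 2 <= dot y y) ->
  k.+1%:R <= \sum_(j < n) dot (a j) (a j) ->
  (\int[prod_prob n mu]_x (kern r a u x)%:E <=
   ((20 * Num.sqrt 2 * expR 1 * C0 * K / r) ^+ k.+1)%:E)%E.
Proof.
move=> K0 r0 mu_le a_small frame ks.
set D := 20 * Num.sqrt 2 * C0 * K / r.
have D0 : 0 < D by rewrite !mulr_gt0 ?invr_gt0 ?sqrtr_gt0.
have -> : 20 * Num.sqrt 2 * expR 1 * C0 * K / r = expR 1 * D by rewrite /D; field; rewrite gt_eqF.
have DE : expR 1 * D = expR (1 + ln D) by rewrite expRD lnK.
rewrite DE -expRM_natl.
have [lD|lD] := leP (ln D + 1 / 2) 0; last first.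
  apply: (@le_trans _ _ (\int[prod_prob n mu]_x 1%:E)%E).
    apply: ge0_le_integral => //.
    - by move=> x _; rewrite lee_fin kern_ge0.
    - by apply/measurable_EFinP; exact: measurable_kern.
    - by move=> x _; rewrite lee_fin kern_le1.
  rewrite (integral_prob_cst (prod_prob n mu)) lee_fin -[leLHS]expR0 ler_expR.
  by apply: mulr_ge0 => //; move: (ln D) lD => l lD; lra.
case: n a_small frame ks => [|n] a_small frame ks.
  by move: ks; rewrite big_ord0 lern0.
pose b j := dot (a j) (a j) + n.+1%:R^-1.
have ab j : dot (a j) (a j) < b j by rewrite ltrDl invr_gt0.
apply: le_trans (integral_kern_le_prod _ K0 r0 mu_le a_small frame ab) _.
rewrite -/D (prod_powR_expR _ (fun j => dot (a j) (a j)))// lee_fin ler_expR.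
rewrite mulfV ?pnatr_eq0//.
move: ks; set s := \sum_(_ < _) _ => ks.
have : s * (ln D + 1 / 2) <= k.+1%:R * (ln D + 1 / 2) by rewrite ler_wnM2r.
have : 1 <= k.+1%:R :> R by rewrite ler1n.
move: (k.+1%:R) => q; nra.
Qed.

Lemma integral_kern_le k n m (mu : nat -> probability R R) (K r : R)
    (a : nat -> V m) (u : V m) :
  0 < K -> 0 < r -> (forall j, law_le (mu j) K) ->
  (forall y, \sum_(j < n) dot (a j) y ^+ 2 <= dot y y) ->
  k%:R <= \sum_(j < n) dot (a j) (a j) ->
  (\int[prod_prob n mu]_x (kern r a u x)%:E <=
   ((20 * Num.sqrt 2 * expR 1 * C0 * K / r) ^+ k)%:E)%E.
Proof.
move=> K0 r0 mu_le; set E := 20 * _ * _ * C0 * K / r.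
have E0 : 0 < E by rewrite !mulr_gt0 ?invr_gt0 ?sqrtr_gt0 ?expR_gt0.
elim: k m a u => [|k IH] m a u frame ks.
  rewrite expr0 -(integral_prob_cst (prod_prob n mu) 1%:E).
  apply: ge0_le_integral => //.
  - by move=> x _; rewrite lee_fin kern_ge0.
  - by apply/measurable_EFinP; exact: measurable_kern.
  - by move=> x _; rewrite lee_fin kern_le1.
have [/existsP[j pj]|/existsPn nbig] := boolP [exists j : 'I_n, 1 / 2 < dot (a j) (a j)];
  last first.
  apply: integral_kern_le_small => // j jn.
  by have := nbig (Ordinal jn); rewrite -leNgt.
case: m a u frame ks pj => [|m] a u frame ks pj.
  by move: pj; rewrite dot0 ltNge divr_ge0.
have [Q [Q' [isoQ [s sE]]]] := gauss_align (a j).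
have [mQ tQ nQ nQ' iQ] := isoQ.
pose al i : R := (Q' (a i)).1; pose B i : V m := (Q' (a i)).2.
have alj : al j = s by rewrite /al sE.
have Bj : B j = vec_of m (fun=> 0) by rewrite /B sE.
have dQ i : dot (a i) (a i) = al i ^+ 2 + dot (B i) (B i) by rewrite -nQ' dotS -expr2.
have s2 : 1 / 2 < s ^+ 2 by move: pj; rewrite dQ alj Bj dot_vec0 addr0.
have s0 : s != 0 by apply: contraTneq s2 => ->; rewrite expr0n/= -leNgt divr_ge0.
have frameQ (y : V m.+1) : \sum_(i < n) (al i * y.1 + dot (B i) y.2) ^+ 2 <= dot y y.
  rewrite -nQ; apply: le_trans _ (frame (Q y)).
  rewrite le_eqVlt; apply/orP; left; apply/eqP.
  by apply: eq_bigr => i _; rewrite tQ dotS.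
have frameB (y : V m) : \sum_(i < n) dot (B i) y ^+ 2 <= dot y y.
  have := frameQ ((0, y) : V m.+1); rewrite [leRHS]dotS/= mul0r add0r.
  by under eq_bigr do rewrite mulr0 add0r.
(* The frame condition at the unit vector along [a j]: this is why projecting loses at most [1]. *)
have al_le1 : \sum_(i < n) al i ^+ 2 <= 1.
  have := frameQ ((1, vec_of m (fun=> 0)) : V m.+1).
  rewrite [leRHS]dotS/= dot_vec0 mulr1 addr0.
  by under eq_bigr do rewrite mulr1 dotC dot_vec0 addr0.
have kB : k%:R <= \sum_(i < n) dot (B i) (B i).
  move: ks; under eq_bigr do rewrite dQ.
  rewrite big_split/= -natr1 -[in X in _ -> X](lerD2r 1) => /le_trans; apply.
  by rewrite addrC lerD2l.
have IHB := IH m B (Q' u).2 frameB kB.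
pose c (x : V n) := \sum_(i < n | i != j) entry x i * al i + (Q' u).1.
(* As [B j = 0], redrawing the coordinate [j] changes only the first factor. *)
have kernE (x : V n) y : kern r a u (upd j y x) =
    gcos (r * s * y + r * c x) * kern r B (Q' u).2 x.
  rewrite (kern_isometry _ _ _ _ isoQ) kernS; congr (gcos _ * _).
    rewrite (bigD1 j)//= entry_upd// eqxx -/(al j) alj -addrA mulrDr mulrA mulrAC.
    congr (_ + r * (_ + _)); apply: eq_bigr => i ij.
    by rewrite entry_upd// (negbTE (ij : (i != j :> nat))).
  rewrite /kern; suff -> : vcomb B (Q' u).2 (upd j y x) = vcomb B (Q' u).2 x by [].
  rewrite /vcomb; congr vec_of; apply/funext => l; congr (_ + _).
  apply: eq_bigr => i _; rewrite entry_upd//.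
  by case: eqP => // ij; rewrite ij Bj entry_vec0 !mulr0.
have mk : measurable_fun setT (fun x : V n => (kern r a u x)%:E).
  by apply/measurable_EFinP; exact: measurable_kern.
have k0 (x : V n) : (0 <= (kern r a u x)%:E)%E by rewrite lee_fin kern_ge0.
rewrite (integral_resample mu (ltn_ord j) mk k0).
have rs0 : r * s != 0 by rewrite mulf_neq0// gt_eqF.
apply: (@le_trans _ _ (\int[prod_prob n mu]_x (E%:E * (kern r B (Q' u).2 x)%:E))%E).
  have mkB : measurable_fun setT (fun x : V n => (kern r B (Q' u).2 x)%:E).
    by apply/measurable_EFinP; exact: measurable_kern.
  apply: ge0_le_integral => //.
  - by move=> x _; exact: integral_ge0.
  - exact: (measurable_resample j (mu j) mk k0).
  - exact: measurable_funeM.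
  - move=> x _.
    rewrite (eq_integral (fun y => (kern r B (Q' u).2 x)%:E *
        (gcos (r * s * y + r * c x))%:E)%E); last first.
      by move=> y _; rewrite kernE -EFinM mulrC.
    rewrite ge0_integralZl ?lee_fin ?kern_ge0//; last 2 first.
    + apply/measurable_EFinP; apply: (measurableT_comp measurable_gcos).
      by apply: measurable_funD => //; exact: measurable_funM.
    + by move=> y _; rewrite lee_fin gcos_ge0.
    rewrite muleC; apply: lee_wpmul2r; first by rewrite lee_fin kern_ge0.
    apply: le_trans (law_le_gcos gcos_int (ltW K0) (mu_le j) _ rs0) _.
    rewrite lee_fin normrM (gtr0_norm r0).
    have sn0 : 0 < `|s| by rewrite normr_gt0.
    (* From [s^2 > 1/2]. The constants [20] and [expR 1] are slack here, kept so that both cases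
       share [E]. *)
    have h1 : 1 <= Num.sqrt 2 * `|s|.
      rewrite -(@ler_pXn2r _ 2) ?nnegrE ?mulr_ge0 ?sqrtr_ge0//.
      rewrite expr1n exprMn sqr_sqrtr// real_normK ?num_real//.
      by rewrite mulrC -ler_pdivrMr// ltW.
    have e1 : 1 <= expR 1 :> R by rewrite -expR0 ler_expR.
    have h2 : 1 <= 20 * expR 1 * (Num.sqrt 2 * `|s|).
      by apply: mulr_ege1 h1; apply: mulr_ege1 e1; rewrite ler1n.
    rewrite [leRHS](_ : _ = K * C0 / (r * `|s|) * (20 * expR 1 * (Num.sqrt 2 * `|s|))).
      by rewrite ler_peMr// !mulr_ge0 ?invr_ge0 ?mulr_ge0// ltW.
    by rewrite /E; field; rewrite !gt_eqF.
rewrite ge0_integralZl//; last 3 first.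
- by apply/measurable_EFinP; exact: measurable_kern.
- by move=> x _; rewrite lee_fin kern_ge0.
- by rewrite lee_fin ltW.
by rewrite exprS [leRHS]EFinM; apply: lee_wpmul2l; rewrite ?lee_fin// ltW.
Qed.

End kernel_estimate.

(** * From independence and densities to product laws *)

Section joint_law.
Context d {T : measurableType d} {R : realType}.
Variable P : probability T R.
Local Notation V m := (@vec R m).
Local Open Scope ereal_scope.

Definition vec_rv n (X : nat -> T -> R) (w : T) : V n := vec_of n (fun k => X k w).

Lemma measurable_vec_rv n (X : nat -> T -> R) :
  (forall k, measurable_fun setT (X k)) -> measurable_fun setT (vec_rv n X).
Proof.
elim: n X => [|n IH] X mX; first exact: (@measurable_cst _ _ T (V 0) _ tt).
apply: (@measurable_fun_pair _ _ _ _ R (V n)); first exact: mX.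
exact: (IH (fun k => X k.+1)).
Qed.

(* Conditioning on an arbitrary event [E] is what makes the induction go
   through: a coordinate peeled off is moved into [E]. *)
Lemma joint_law_cond n (X : nat -> T -> R) (mu : nat -> probability R R) (E : set T)
    (D : set (V n)) :
  (forall k, measurable_fun setT (X k)) -> measurable E ->
  (forall B : nat -> set R, (forall i, measurable (B i)) ->
    P (E `&` [set w | forall i, (i < n)%N -> B i (X i w)]) =
    P E * \prod_(i < n) mu i (B i)) ->
  measurable D ->
  P (E `&` vec_rv n X @^-1` D) = P E * prod_prob n mu D.
Proof.
elim: n X mu E D => [|n IH] X mu E D mX mE indep mD.
  have [Dt|Dt] := pselect (D tt).
    have -> : vec_rv 0 X @^-1` D = setT by apply/seteqP; split.
    have -> : D = setT by apply/seteqP; split => // -[].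
    by rewrite setIT [X in _ * X](probability_setT (prod_prob 0 mu)) mule1.
  have -> : vec_rv 0 X @^-1` D = set0 by apply/seteqP; split.
  have -> : D = set0 by apply/seteqP; split => // -[].
  by rewrite setI0 !measure0 mule0.
have mW := measurable_vec_rv (n := n.+1) mX.
have mWD : measurable (vec_rv n.+1 X @^-1` D).
  by rewrite -[_ @^-1` _]setTI; exact: mW.
have [PE0|PE0] := eqVneq (P E) 0.
  rewrite PE0 mul0e; apply/eqP; rewrite eq_le measure_ge0 andbT -PE0.
  by apply: le_measure; rewrite ?inE//; exact: measurableI.
have PEfin : P E \is a fin_num by exact: fin_num_measure.
pose p := fine (P E).
have pE : P E = p%:E by rewrite fineK.
have p0 : (0 < p)%R.
  by rewrite -lte_fin -pE lt_neqAle eq_sym PE0 measure_ge0.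
have pV0 : (0 <= p^-1)%R by rewrite invr_ge0 ltW.
(* The law of the vector conditioned on [E]; dividing by [P E] is why [P E = 0] was treated apart.
   On rectangles the event of the first coordinate joins [E], and uniqueness of the product measure
   concludes. *)
pose m' : {measure set (R * V n)%type -> \bar R} :=
  mscale (NngNum pV0) (image_measure (mrestr P mE) mW).
have m'E A : m' A = (p^-1)%:E * P (vec_rv n.+1 X @^-1` A `&` E) by [].
have step A B : measurable A -> measurable B ->
    m' (A `*` B) = mu 0%N A * prod_prob n (fun k => mu k.+1) B.
  move=> mA mB; rewrite m'E.
  have mX0A : measurable (X 0%N @^-1` A) by rewrite -[_ @^-1` _]setTI; exact: mX.
  have -> : vec_rv n.+1 X @^-1` (A `*` B) `&` E =
      (E `&` X 0%N @^-1` A) `&` vec_rv n (fun k => X k.+1) @^-1` B.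
    by apply/seteqP; split => w /=; [move=> [[? ?] ?]|move=> [[? ?] ?]].
  have PEA : P (E `&` X 0%N @^-1` A) = P E * mu 0%N A.
    have := indep (fun i => if i is 0%N then A else setT).
    rewrite big_ord_recl/= big1 ?mule1; last first.
      by move=> i _; exact: (probability_setT (mu _)).
    move=> <-; last by case.
    congr (P (_ `&` _)); apply/seteqP; split => w /=; first by move=> ? [|i].
    by move=> /(_ 0%N isT).
  rewrite (IH _ (fun k => mu k.+1)) ?PEA//.
  - rewrite pE -(muleA p%:E) (muleA (p^-1)%:E) -EFinM mulVf ?mul1e//.
    by rewrite gt_eqF.
  - exact: measurableI.
  - move=> B' mB'.
    have := indep (fun i => if i is i'.+1 then B' i' else A).
    rewrite big_ord_recl/= muleA -PEA => <-; last by case.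
    rewrite -setIA; congr (P (_ `&` _)); apply/seteqP; split => w /=.
      by move=> [? h] [|i]//= /h.
    by move=> h; split; [exact: (h 0%N)|move=> i; exact: (h i.+1)].
have := product_measure_unique step mD.
rewrite m'E setIC => e; rewrite [X in _ = _ * X](e : prod_prob n.+1 mu D = _).
by rewrite pE muleA -EFinM mulfV ?gt_eqF// mul1e.
Qed.

Lemma integral_joint_law n (X : nat -> T -> R) (mu : nat -> probability R R)
    (h : V n -> \bar R) :
  (forall k, measurable_fun setT (X k)) ->
  (forall B : nat -> set R, (forall i, measurable (B i)) ->
    P [set w | forall i, (i < n)%N -> B i (X i w)] = \prod_(i < n) mu i (B i)) ->
  measurable_fun setT h -> (forall x, 0 <= h x) ->
  \int[P]_w h (vec_rv n X w) = \int[prod_prob n mu]_x h x.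
Proof.
move=> mX indep mh h0; have mW := measurable_vec_rv (n := n) mX.
rewrite -(integral_image_measure P mW mh h0).
apply: eq_measure_integral => D mD _.
have := @joint_law_cond n X mu setT D mX measurableT.
rewrite setTI (probability_setT P) mul1e; apply => // B mB.
by rewrite setTI mul1e indep.
Qed.

(** The sign of [K] is not known at first, so the bound on sets is stated for any [M] above both [K]
    and [0]: [K <= 0] would allow [M = 0] and a total mass of [0]. Domination on sets then extends
    to integrals. *)
Lemma law_le_density (X : {RV P >-> R}) (f : R -> R) (K : R) :
  has_density X f -> {ae lebesgue_measure, forall x, f x <= K}%R ->
  (0 < K)%R /\ law_le (distribution P X) K.
Proof.
move=> [mf f0 fE] fK.
have mfE : measurable_fun [set: R] (EFin \o f) by exact/measurable_EFinP.
have le_set (M : R) (B : set R) : (0 <= M)%R -> (K <= M)%R -> measurable B ->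
    distribution P X B <= M%:E * lebesgue_measure B.
  move=> M0 KM mB; rewrite fE// -integral_cst//.
  apply: ae_ge0_le_integral => //.
  - by move=> x _; rewrite lee_fin.
  - exact: measurable_funTS.
  - have [N [mN N0 subN]] := fK; exists N; split => // x /= nx; apply: subN => /= fxK.
    by apply: nx => _; rewrite lee_fin (le_trans fxK).
have K0 : (0 < K)%R.
  rewrite ltNge; apply/negP => K0.
  have := le_set 0%R setT (lexx _) K0 measurableT.
  by rewrite mul0e [X in X <= _](probability_setT (distribution P X)) lee_fin ler10.
split => // h mh h0.
pose k := NngNum (ltW K0).
pose nu : {measure set (measurableTypeR R) -> \bar R} :=
  mscale k (@lebesgue_measure R).
have mX0 : measurable_fun setT (X : T -> R) by exact: measurable_funPT.
have mX : measurable_fun setT (X : T -> measurableTypeR R) by exact: mX0.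
have le_nu S : measurable S -> image_measure P mX S <= nu S.
  by move=> mS; exact: (le_set K S (ltW K0) (lexx _) mS).
have -> : \int[distribution P X]_x h x = \int[image_measure P mX]_x h x.
  by rewrite integral_image_measure// ge0_integral_pushforward.
apply: le_trans (ge0_le_measure_integral le_nu measurableT h0 mh) _.
by rewrite ge0_integral_mscale.
Qed.

End joint_law.

(** * Operator norm and conclusion *)

Section operator_norm.
Context {R : realType}.

Lemma norm2_sqr k (v : 'cV[R]_k) : norm2 v ^+ 2 = \sum_i v i ord0 ^+ 2.
Proof. by rewrite sqr_sqrtr// sumr_ge0// => i _; rewrite sqr_ge0. Qed.

Lemma norm2_ge0 k (v : 'cV[R]_k) : 0 <= norm2 v.
Proof. exact: sqrtr_ge0. Qed.

Lemma norm2Z k (c : R) (v : 'cV[R]_k) : norm2 (c *: v) = `|c| * norm2 v.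
Proof.
rewrite /norm2 -sqrtr_sqr -sqrtrM ?sqr_ge0// mulr_sumr; congr Num.sqrt.
by apply: eq_bigr => i _; rewrite mxE exprMn.
Qed.

Lemma entry_le_norm2 k (v : 'cV[R]_k) i : `|v i ord0| <= norm2 v.
Proof.
rewrite -(@ler_pXn2r _ 2) ?nnegrE ?norm2_ge0// real_normK ?num_real// norm2_sqr.
by rewrite (bigD1 i)//= lerDl sumr_ge0// => j _; rewrite sqr_ge0.
Qed.

Lemma norm2_eq0 k (v : 'cV[R]_k) : norm2 v = 0 -> v = 0.
Proof.
move=> v0; apply/matrixP => i j; rewrite ord1 mxE.
by apply/eqP; rewrite -normr_le0 -v0 entry_le_norm2.
Qed.

Variables (m n : nat) (A : 'M[R]_(m, n)).

Let S : set R := [set norm2 (A *m x) | x in [set x : 'cV[R]_n | norm2 x <= 1]].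

(** The [sup] in [op_norm] is an upper bound only for a set bounded above. Absolute row sums supply
    the bound, as the entries of [x] are at most [1] in modulus. *)
Let has_ubound_S : has_ubound S.
Proof.
exists (Num.sqrt (\sum_i (\sum_j `|A i j|) ^+ 2)) => _ [x /= x1 <-].
rewrite /norm2 ler_sqrt; last by apply: sumr_ge0 => i _; rewrite sqr_ge0.
apply: ler_sum => i _; rewrite mxE -(real_normK (num_real (\sum_j _))).
rewrite ler_pXn2r ?nnegrE ?sumr_ge0//.
apply: le_trans (ler_norm_sum _ _ _) _; apply: ler_sum => j _.
by rewrite normrM ler_piMr// (le_trans (entry_le_norm2 x j)).
Qed.

Lemma op_norm_ge0 : 0 <= op_norm A.
Proof.
apply: (@le_trans _ _ (norm2 (A *m (0 : 'cV[R]_n)))); first exact: norm2_ge0.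
apply: ub_le_sup => //; exists 0 => //=.
by rewrite -(scale0r (0 : 'cV[R]_n)) norm2Z normr0 mul0r.
Qed.

Lemma op_norm_bound x : norm2 (A *m x) <= op_norm A * norm2 x.
Proof.
have [x0|x0] := eqVneq (norm2 x) 0.
  rewrite (norm2_eq0 x0) mulmx0 -{1}(scale0r (0 : 'cV[R]_m)) norm2Z normr0 mul0r.
  by rewrite mulr_ge0 ?op_norm_ge0 ?norm2_ge0.
have xp : 0 < norm2 x by rewrite lt_neqAle eq_sym x0 norm2_ge0.
rewrite -ler_pdivrMr// mulrC.
have -> : (norm2 x)^-1 * norm2 (A *m x) = norm2 (A *m ((norm2 x)^-1 *: x)).
  by rewrite -scalemxAr norm2Z ger0_norm// invr_ge0 ltW.
apply: ub_le_sup => //; exists ((norm2 x)^-1 *: x) => //=.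
by rewrite norm2Z ger0_norm ?invr_ge0 ?(ltW xp)// mulVf.
Qed.

Lemma op_norm_gt0 : A != 0 -> 0 < op_norm A.
Proof.
move=> A0; rewrite lt_neqAle op_norm_ge0 andbT eq_sym.
apply: contra_neq A0 => op0; apply/matrixP => i j; rewrite mxE.
have := op_norm_bound (delta_mx j ord0); rewrite op0 mul0r => h.
have /norm2_eq0 : norm2 (A *m delta_mx j (ord0 : 'I_1)) = 0.
  by apply/eqP; rewrite eq_le h norm2_ge0.
by rewrite -colE => /matrixP/(_ i ord0); rewrite !mxE.
Qed.

(** The transpose obeys the same bound, by duality: with [x = A^T y] and [s = |A|^2], [2 |x|^2 = 2
    <A x, y> <= |A x|^2 / s + s |y|^2 <= |x|^2 + s |y|^2]. *)
Lemma op_norm_frame (y : 'I_m -> R) : A != 0 ->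
  \sum_j (\sum_i A i j * y i) ^+ 2 <= op_norm A ^+ 2 * \sum_i y i ^+ 2.
Proof.
move=> A0; have op0 := op_norm_gt0 A0.
pose x : 'cV[R]_n := \col_j \sum_i A i j * y i.
have xE : norm2 x ^+ 2 = \sum_j (\sum_i A i j * y i) ^+ 2.
  by rewrite norm2_sqr; apply: eq_bigr => j _; rewrite mxE.
have Ax : norm2 (A *m x) ^+ 2 <= op_norm A ^+ 2 * norm2 x ^+ 2.
  by rewrite -exprMn ler_pXn2r ?nnegrE ?mulr_ge0 ?norm2_ge0 ?op_norm_bound// ltW.
have cross : \sum_i (A *m x) i ord0 * y i = norm2 x ^+ 2.
  rewrite xE; under eq_bigr do rewrite mxE mulr_suml.
  rewrite exchange_big/=; apply: eq_bigr => j _.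
  rewrite expr2 mulr_suml; apply: eq_bigr => i _.
  by rewrite [x j ord0]mxE mulrAC.
rewrite -xE; set s := op_norm A ^+ 2; have s0 : 0 < s by rewrite exprn_gt0.
have : 2 * norm2 x ^+ 2 <= norm2 (A *m x) ^+ 2 / s + s * \sum_i y i ^+ 2.
  rewrite -cross norm2_sqr mulr_sumr mulr_suml mulr_sumr -big_split/=.
  apply: ler_sum => i _; set t := (A *m x) i ord0.
  rewrite -subr_ge0 [leRHS](_ : _ = (t - s * y i) ^+ 2 / s); last by field; rewrite gt_eqF.
  by rewrite divr_ge0 ?sqr_ge0// ltW.
have : norm2 (A *m x) ^+ 2 / s <= norm2 x ^+ 2 by rewrite ler_pdivrMr// mulrC.
lra.
Qed.

End operator_norm.

Theorem corollary8p6 (R : realType) :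
  exists C : R, 0 < C /\
    forall (d : measure_display) (T : measurableType d) (P : probability T R)
      (m n : nat) (X : 'I_n -> {RV P >-> R}) (f : 'I_n -> R -> R) (K : R)
      (A : 'M[R]_(m, n)) (tau : R),
    mutually_independent X ->
    (forall i, has_density (X i) (f i)) ->
    (forall i, {ae lebesgue_measure, forall x, f i x <= K}) ->
    A != 0 ->
    0 < tau ->
    (concentration P (fun w => A *m rv_col X w) (tau * op_norm A)
       <= ((C * K * tau) ^+ stable_rank A)%:E)%E.
Proof.
have [C0 [C0_gt0 gcos_int]] := @gcos_integrable R.
have [r0 [r0_gt0 near0]] := @gcos_near0 R.
pose C1 : R := 20 * Num.sqrt 2 * expR 1 * C0.
have C1_gt0 : 0 < C1 by rewrite !mulr_gt0 ?sqrtr_gt0 ?expR_gt0.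
(* [C1] comes from the kernel estimate, [1 / r0] from the scale [r = r0 / tau], and [2] from the
   kernel being at least [1/2] on the ball. *)
exists (2 * C1 / r0); split; first by rewrite !mulr_gt0 ?invr_gt0.
move=> d T P m n X f K A tau indep dens densK A0 tau0.
have op0 := op_norm_gt0 A0.
case: m A A0 op0 => [|m] A A0 op0.
  by case/eqP: A0; apply/matrixP => -[].
case: n X f A indep dens densK A0 op0 => [|n] X f A indep dens densK A0 op0.
  by case/eqP: A0; apply/matrixP => i [].
set op := op_norm A in op0 *.
(* Indices out of range repeat a coordinate, so the density bound holds along the whole sequence. *)
pose X' (k : nat) : {RV P >-> R} := X (inord k).
have lawX k := law_le_density (dens (inord k)) (densK (inord k)).
have K0 : 0 < K by have [] := lawX 0%N.
pose mu k : probability R R := distribution P (X' k).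
have mu_le k : law_le (mu k) K by have [] := lawX k.
have mX' k : measurable_fun setT (X' k : T -> R) by exact: measurable_funPT.
have indep' (B : nat -> set R) : (forall i, measurable (B i)) ->
    P [set w | forall i, (i < n.+1)%N -> B i (X' i w)] =
    (\prod_(i < n.+1) mu i (B i))%E.
  move=> mB; have := indep [set: 'I_n.+1]%SET (fun i => B i) (fun i => mB i).
  have -> : \bigcap_(i in [set` [set: 'I_n.+1]%SET]) X i @^-1` B i =
      [set w | forall i, (i < n.+1)%N -> B i (X' i w)].
    apply/seteqP; split => w /= h.
      move=> i ni; have := h (Ordinal ni); rewrite /= inE => /(_ isT).
      by rewrite /X' (_ : inord i = Ordinal ni)//; apply: val_inj; rewrite /= inordK.
    by move=> i _; have := h i (ltn_ord i); rewrite /X' inord_val.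
  move=> ->; apply: eq_big => [i|i _]; first by rewrite inE.
  by rewrite /mu /distribution /pushforward /X' inord_val.
pose a j : @vec R m.+1 := vec_of m.+1 (fun i => A (inord i) (inord j) / op).
have aE (i : 'I_m.+1) (j : 'I_n.+1) : entry (a j) i = A i j / op.
  by rewrite entry_vec_of// !inord_val.
have frame y : \sum_(j < n.+1) dot (a j) y ^+ 2 <= dot y y.
  have := op_norm_frame (fun i => entry y i) A0; rewrite -/op.
  rewrite [X in _ <= _ * X](_ : _ = dot y y); last by apply: eq_bigr => i _; rewrite expr2.
  rewrite mulrC -ler_pdivrMr ?exprn_gt0//; apply: le_trans.
  rewrite mulr_suml le_eqVlt; apply/orP; left; apply/eqP.
  apply: eq_bigr => j _; rewrite -expr_div_n mulr_suml; congr (_ ^+ 2).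
  by apply: eq_bigr => i _; rewrite aE mulrAC.
have hs : (stable_rank A)%:R <= \sum_(j < n.+1) dot (a j) (a j).
  have q0 : 0 <= hs_norm A ^+ 2 / op ^+ 2 by rewrite divr_ge0// sqr_ge0.
  apply: (@le_trans _ _ (hs_norm A ^+ 2 / op ^+ 2)); first by rewrite truncn_le.
  rewrite sqr_sqrtr; last by do 2 (apply: sumr_ge0 => ? _); rewrite sqr_ge0.
  rewrite exchange_big/= mulr_suml le_eqVlt; apply/orP; left; apply/eqP.
  apply: eq_bigr => j _; rewrite mulr_suml; apply: eq_bigr => i _.
  by rewrite aE -expr2 expr_div_n.
set k := stable_rank A in hs *.
apply: ge_ereal_sup => _ [u _ <-].
pose u' : @vec R m.+1 := vec_of m.+1 (fun i => - u (inord i) ord0 / op).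
pose W := vec_rv n.+1 (fun k => X' k : T -> R).
have normE w : norm2 (A *m rv_col X w - u) =
    op * Num.sqrt (dot (vcomb a u' (W w)) (vcomb a u' (W w))).
  rewrite -{1}(ger0_norm (ltW op0)) -sqrtr_sqr -sqrtrM ?sqr_ge0//.
  rewrite /norm2 mulr_sumr; congr Num.sqrt; apply: eq_bigr => i _.
  rewrite -expr2 -exprMn; congr (_ ^+ 2).
  rewrite entry_vec_of// entry_vec_of// inord_val !mxE mulrDr mulr_sumr.
  congr (_ + _); last by rewrite mulrC divfK// gt_eqF.
  apply: eq_bigr => j _; rewrite entry_vec_of// aE mxE /X' inord_val.
  by field; rewrite gt_eqF.
set S := [set w | norm2 (A *m rv_col X w - u) <= tau * op].
have SE : S = [set w | Num.sqrt (dot (vcomb a u' (W w)) (vcomb a u' (W w))) <= tau].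
  by apply/seteqP; split => w; rewrite /S/= normE mulrC ler_pM2r.
have mW : measurable_fun setT W by exact: measurable_vec_rv.
have mS : measurable S.
  pose g w := Num.sqrt (dot (vcomb a u' (W w)) (vcomb a u' (W w))).
  have mg : measurable_fun setT g.
    exact: (measurableT_comp (measurable_sqrt_vcomb a u') mW).
  have -> : S = setT `&` g @^-1` `]-oo, tau]%classic.
    by rewrite SE setTI; apply/seteqP; split => w /=; rewrite in_itv.
  by apply: mg => //; exact: measurable_itv.
(* At [k = 0] the bound is [1]; for [k > 0] the factor [2] is absorbed into [2 ^ k] at the end. *)
have [k0|k0] := posnP k; first by rewrite k0 expr0 probability_le1.
pose r := r0 / tau; have r_gt0 : 0 < r by rewrite divr_gt0.
have mkern : measurable_fun setT (fun x : @vec R n.+1 => (kern r a u' x)%:E).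
  by apply/measurable_EFinP; exact: measurable_kern.
have kern0 (x : @vec R n.+1) : (0 <= (kern r a u' x)%:E)%E by rewrite lee_fin kern_ge0.
have int_kern : (\int[P]_w (kern r a u' (W w))%:E <= ((C1 * K / r) ^+ k)%:E)%E.
  rewrite (integral_joint_law mX' indep' mkern kern0).
  exact: (integral_kern_le C0_gt0 gcos_int u' K0 r_gt0 mu_le frame hs).
(* Markov's inequality: on [S] the argument of [gcos] is at most [r0], so the kernel is at least
   [1/2] there. *)
have PS : (P S <= 2%:E * \int[P]_w (kern r a u' (W w))%:E)%E.
  rewrite -ge0_integralZl//; last exact: (measurableT_comp mkern mW).
  rewrite -[X in P X]setIT -integral_indic//.
  apply: ge0_le_integral => //.
  - by apply/measurable_EFinP; exact: measurable_indic.
  - by apply: measurable_funeM; exact: (measurableT_comp mkern mW).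
  - move=> w _; rewrite -EFinM lee_fin indicE.
    case: (boolP (w \in S)) => [|_]; last by rewrite mulr_ge0// kern_ge0.
    rewrite inE SE /= => wS; rewrite mulrC -ler_pdivrMr//.
    apply: near0; rewrite (ger0_norm (mulr_ge0 (ltW r_gt0) (sqrtr_ge0 _))).
    by rewrite /r mulrAC ler_pdivrMr// ler_wpM2l// ltW.
apply: le_trans PS _; apply: (@le_trans _ _ (2%:E * ((C1 * K / r) ^+ k)%:E)%E).
  exact: lee_wpmul2l.
rewrite -EFinM lee_fin.
have -> : 2 * C1 / r0 * K * tau = 2 * (C1 * K / r).
  by rewrite /r; field; rewrite !gt_eqF.
have b0 : 0 <= (C1 * K / r) ^+ k.
  apply: exprn_ge0; rewrite divr_ge0 ?(ltW r_gt0)//.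
  by apply: mulr_ge0; exact: ltW.
rewrite [leRHS]exprMn; apply: ler_wpM2r => //.
by rewrite -[leLHS]expr1 ler_weXn2l// ler1n.
Qed.
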